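(* Let $d\ge 1$, let $K\subset\mathbb R^d$ be a compact set equipped with a $\delta$-Ahlfors regular probability measure $\mu$, and let $\boldsymbol\theta\in\mathbb R^d$, $0<\beta<1$ and $\alpha$ with $\frac1d<\alpha<\frac{1+\delta-\beta\delta}{d-\delta}$. Suppose that $\mu$ satisfies the $(\alpha,\beta,\boldsymbol\theta)$-local counting property. Let $\psi:\mathbb N\to\mathbb R_+$ be a monotonic function. If $1/d<\tau(\psi)<\alpha$, then \[\dim_H\big(K\cap W_d(\psi,\boldsymbol\theta)\big)\le \delta+\frac{d+1}{1+\tau(\psi)}-d\] and \[\dim_H\big(K\cap W_d(\psi,\boldsymbol\theta)\big)\ge \min\Big\{\delta-\frac{(\tau(\psi)d-1)\big(\delta+\frac{1+d}{1+\tau(\psi)}-d\big)}{\beta\delta},\ \delta+\frac{1+d}{1+\tau(\psi)}-d\Big\}.\] Moreover, suppose $\delta>d-1$, $\boldsymbol\theta=\mathbf 0$, and there are constants $c>0$ and $\tau$ with $1/d<\tau<\min\{\alpha,\frac{\delta+2-d}{2d-\delta-1}\}$ such that $\psi(q)\ge cq^{-\tau}$ for infinitely many $q$. Then $\mathcal H^s\big(K\cap W_d(\psi,\mathbf 0)\big)=\infty$, where \[s=\min\Big\{\delta-\frac{(\tau-\frac1d)(2d-\delta-1)\big(\delta+\frac{1+d}{1+\tau}-d\big)}{\beta\delta},\ \delta+\frac{1+d}{1+\tau}-d\Big\};\] in particular $s$ is a lower bound for $\dim_H(K\cap W_d(\psi,\mathbf 0))$.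
   Context: For $\mathbf x\in\mathbb R^d$, $|\mathbf x|$ is the supremum norm and $\|\mathbf x\|$ denotes the (sup-norm) distance from $\mathbf x$ to the nearest point of $\mathbb Z^d$; $|E|$ is the diameter of a set $E$, and $\mathcal H^s$, $\dim_H$ denote Hausdorff measure and dimension. For $\psi:\mathbb N\to\mathbb R_+$ and $\boldsymbol\theta\in\mathbb R^d$, $W_d(\psi,\boldsymbol\theta)=\{\mathbf x\in\mathbb R^d:\|q\mathbf x-\boldsymbol\theta\|<\psi(q)\text{ for infinitely many }q\in\mathbb Z\}$. The lower order of $\psi$ is $\tau(\psi)=\liminf_{q\to\infty}\frac{-\log\psi(q)}{\log q}$. A probability measure $\mu$ on a compact set $K$ is $\delta$-Ahlfors regular ($\delta>0$) if there is $C\ge1$ with $C^{-1}r^\delta\le\mu(B(\mathbf x,r))\le Cr^\delta$ for all $\mathbf x\in K$ and $0<r<|K|$. For $Q>1$, $\eta>0$, $A_Q(\eta,\boldsymbol\theta)=\{\mathbf x\in\mathbb R^d:\|q\mathbf x-\boldsymbol\theta\|<\eta\text{ for some integer }Q\le q<2Q\}$. For $\alpha>1/d$, $\beta>0$, $\mu$ satisfies the $(\alpha,\beta,\boldsymbol\theta)$-local counting property if there exist $Q_0$ (depending only on $\alpha,\beta$) and $C\ge 1$ such that for all $Q\ge Q_0$, all $Q^{-\alpha}\le\eta\le Q^{-1/d}$, and all balls $B$ with centre in the support of $\mu$ and $|B|\ge Q^{-\beta}$, one has $C^{-1}\mu(B)Q\eta^d\le\mu(B\cap A_Q(\eta,\boldsymbol\theta))\le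 C\mu(B)Q\eta^d$. *)

(* Defs.v *)
From HB Require Import structures.
From mathcomp Require Import all_boot all_order all_algebra.
From mathcomp Require Import all_classical all_reals all_analysis.

Set Implicit Arguments.
Unset Strict Implicit.
Unset Printing Implicit Defensive.

Import Order.TTheory GRing.Theory Num.Theory.
Import numFieldNormedType.Exports.

Local Open Scope classical_set_scope.
Local Open Scope ring_scope.

(* The library norm `|x| and the library balls of 'rV[R]_d are those of the   *)
(* supremum norm; balls are open.                                             *)

Notation borel_rV R d := (g_sigma_algebraType (@open 'rV[R]_d)).

Definition diam (R : realType) (V : normedModType R) (E : set V) : \bar R :=
  maxe 0%E (ereal_sup [set e | exists x y, [/\ E x, E y & e = `|x - y|%:E]]).

(* The term |U|^s of a cover, with the conventions |set0|^s = 0, 0^0 = 1 and  *)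
(* 0^s = +oo for s < 0 (powR has 0 `^ s = 0 in the last case).                *)
Definition hgauge (R : realType) (V : normedModType R) (s : R) (U : set V) :
    \bar R :=
  if U == set0 then 0%E
  else if (s < 0) && (diam U == 0%E) then +oo%E
  else poweR (diam U) s.

Definition hausdorff_premeasure (R : realType) (V : normedModType R)
    (s rho : R) (E : set V) : \bar R :=
  ereal_inf [set (\sum_(0 <= i <oo) hgauge s (U i))%E | U in
    [set U : (set V)^nat | E `<=` \bigcup_i U i /\
                           forall i, (diam (U i) <= rho%:E)%E]].

Definition hausdorff_measure (R : realType) (V : normedModType R)
    (s : R) (E : set V) : \bar R :=
  ereal_sup [set hausdorff_premeasure s rho E | rho in [set rho : R | 0 < rho]].

Definition hausdorff_dim (R : realType) (V : normedModType R) (E : set V) :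
    \bar R :=
  ereal_inf [set s%:E | s in
    [set s : R | 0 <= s /\ hausdorff_measure s E = 0%E]].

Definition dist_Zd (R : realType) (d : nat) (x : 'rV[R]_d) : R :=
  inf [set `|x - map_mx intr p| | p in [set: 'rV[int]_d]].

(* psi is only given on the positive integers, so that the inequality         *)
(* ||q x - theta|| < psi q is only meaningful for q >= 1.                     *)
Definition W_set (R : realType) (d : nat) (psi : nat -> R) (theta : 'rV[R]_d) :
    set 'rV[R]_d :=
  [set x | infinite_set
    [set q : nat | (0 < q)%N /\ dist_Zd (q%:R *: x - theta) < psi q]].

(* lne 0 = -oo, so a zero value of psi contributes +oo.                       *)
Definition lower_order (R : realType) (psi : nat -> R) : \bar R :=
  limn_einf (fun q : nat => (- lne (psi q)%:E / (ln q%:R)%:E)%E).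

Definition monotonic (R : realType) (psi : nat -> R) : Prop :=
  (forall p q : nat, (0 < p)%N -> (p <= q)%N -> psi p <= psi q) \/
  (forall p q : nat, (0 < p)%N -> (p <= q)%N -> psi q <= psi p).

Definition ahlfors_regular (R : realType) (d : nat)
    (mu : set (borel_rV R d) -> \bar R) (K : set 'rV[R]_d) (delta : R) : Prop :=
  exists2 C : R, 1 <= C &
    forall (x : 'rV[R]_d) (r : R), K x -> 0 < r -> (r%:E < diam K)%E ->
      ((C^-1 * r `^ delta)%:E <= mu (ball x r))%E /\
      (mu (ball x r) <= (C * r `^ delta)%:E)%E.

Definition measure_support (R : realType) (d : nat)
    (mu : set (borel_rV R d) -> \bar R) : set 'rV[R]_d :=
  [set x | forall r : R, 0 < r -> (0 < mu (ball x r))%E].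

Definition A_set (R : realType) (d : nat) (Q eta : R) (theta : 'rV[R]_d) :
    set 'rV[R]_d :=
  [set x | exists q : int, [/\ Q <= q%:~R, q%:~R < 2 * Q &
                               dist_Zd (q%:~R *: x - theta) < eta]].

Definition local_counting (R : realType) (d : nat)
    (mu : set (borel_rV R d) -> \bar R) (alpha beta : R) (theta : 'rV[R]_d) :
    Prop :=
  exists Q0 C : R, 1 <= C /\
    forall Q eta : R, 1 < Q -> Q0 <= Q ->
      Q `^ (- alpha) <= eta -> eta <= Q `^ (- (d%:R^-1)) ->
      forall (x : 'rV[R]_d) (r : R), measure_support mu x -> 0 < r ->
        ((Q `^ (- beta))%:E <= diam (ball x r))%E ->
        ((C^-1)%:E * mu (ball x r) * (Q * eta ^+ d)%:E
           <= mu (ball x r `&` A_set Q eta theta))%E /\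
        (mu (ball x r `&` A_set Q eta theta)
           <= C%:E * mu (ball x r) * (Q * eta ^+ d)%:E)%E.

(* Main.v *)
Require Import Defs.
From HB Require Import structures.
From mathcomp Require Import all_boot all_order all_algebra fingroup perm.
From mathcomp Require Import all_classical all_reals all_analysis.
From mathcomp Require Import finmap ring lra.
Import Order.TTheory GRing.Theory Num.Theory.
Import numFieldNormedType.Exports.

Set Implicit Arguments.
Unset Strict Implicit.
Unset Printing Implicit Defensive.

Local Open Scope classical_set_scope.
Local Open Scope ring_scope.

(* For the upper bound, local counting bounds the number of balls of radius
   eta / Q needed to cover the part of K in A_Q(eta).

   For the lower bounds, let h_Q be the restriction of mu to A_Q(Q^-tau), divided
   by Q^(1 - tau d).  It is comparable with mu on balls of radius r >= Q^-beta; on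
   smaller balls it is at most a constant times Q^(-beta delta) and times
   r^delta Q^kappa, hence at most a constant times r^s as soon as
   kappa s <= beta delta (delta - s).  Trivially kappa = tau d - 1 is allowed.  When
   theta = 0, the rational points of denominator about Q in a ball of radius
   c Q^(-1-1/d) lie on a hyperplane (simplex lemma), and covering a neighbourhood of
   that hyperplane gives kappa = (tau - 1/d)(2 d - delta - 1) for larger balls and
   the bound r^s with s = delta + (1+d)/(1+tau) - d for smaller ones.  The exponents
   of the theorem satisfy these constraints.

   A Cantor construction in the style of the mass transference principle then
   concludes: at each stage the mass near the points of a fine net of K is
   redistributed proportionally to an average of h_Q over many very sparse values of
   Q.  Only one Q at a time contributes the critical growth r^s, so the average has
   an arbitrarily small constant, which yields infinite measure even at the critical
   exponent.  No limit measure is needed: by compactness a cover of the limit set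
   already covers the support of some stage. *)

(** * Hausdorff measure and dimension *)

Section Hausdorff.
Context {R : realType} {V : normedModType R}.
Implicit Types (E U : set V) (s : R).

Lemma diam_ge0 E : (0 <= diam E)%E.
Proof. by rewrite /diam le_max lexx. Qed.

Lemma dist_le_diam E x y : E x -> E y -> (`|x - y|%:E <= diam E)%E.
Proof.
move=> Ex Ey; rewrite /diam le_max; apply/orP; right.
by apply: ereal_sup_ubound; exists x, y.
Qed.

Lemma diam_le E (m : R) : 0 <= m ->
  (forall x y, E x -> E y -> `|x - y| <= m) -> (diam E <= m%:E)%E.
Proof.
move=> m0 h; rewrite /diam ge_max lee_fin m0 /=.
by apply: ge_ereal_sup => _ [x [y [Ex Ey ->]]]; rewrite lee_fin h.
Qed.

Lemma hgauge_ge0 s U : (0 <= hgauge s U)%E.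
Proof. by rewrite /hgauge; case: ifP => // _; case: ifP => // _; exact: poweR_ge0. Qed.

Lemma hgauge_le s s' U : s <= s' -> (diam U <= 1)%E ->
  (hgauge s' U <= hgauge s U)%E.
Proof.
move=> ss' dU; rewrite /hgauge; case: ifP => // _.
have : (0 <= diam U)%E by exact: diam_ge0.
move: dU; case: (diam U) => [r| |] //; rewrite !lee_fin eqe => r1 r0.
have [r00|rN0] := eqVneq r 0.
- have [s0|s0] /= := ltP s 0.
    by case: ifP => _; rewrite leey.
  rewrite ltNge (le_trans s0 ss') /= lee_fin.
  have [s00|sN0] := eqVneq s 0.
    rewrite s00 powRr0 r00; have [->|s'N] := eqVneq s' 0; first by rewrite powRr0.
    by rewrite powR0.
  rewrite r00 !powR0 //; apply/negP => /eqP s'0; move: ss'.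
  by rewrite s'0 leNgt lt_neqAle eq_sym sN0 s0.
- rewrite !andbF lee_fin; apply: ger_powR => //.
  by rewrite r1 andbT lt_neqAle eq_sym rN0.
Qed.

Lemma hausdorff_premeasure_ge0 s (rho : R) E :
  (0 <= hausdorff_premeasure s rho E)%E.
Proof.
apply: le_ereal_inf_tmp => _ [U _ <-].
by apply: nneseries_ge0 => i _ _; exact: hgauge_ge0.
Qed.

Lemma hausdorff_premeasure_le s (rho rho' : R) E : rho <= rho' ->
  (hausdorff_premeasure s rho' E <= hausdorff_premeasure s rho E)%E.
Proof.
move=> rr; apply: ereal_inf_le_tmp => _ [U [EU dU] <-]; exists U => //; split=> // i.
by apply: le_trans (dU i) _; rewrite lee_fin.
Qed.

Lemma hausdorff_premeasure_le_exponent s s' (rho : R) E : rho <= 1 -> s <= s' ->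
  (hausdorff_premeasure s' rho E <= hausdorff_premeasure s rho E)%E.
Proof.
move=> r1 ss'; apply: le_ereal_inf_tmp => _ [U [EU dU] <-].
apply: (@le_trans _ _ (\sum_(0 <= i <oo) hgauge s' (U i))%E).
  by apply: ereal_inf_lbound; exists U.
apply: lee_nneseries => i; first by move=> *; exact: hgauge_ge0.
move=> *; by apply: hgauge_le => //; apply: le_trans (dU i) _; rewrite lee_fin.
Qed.

Lemma hausdorff_measure_le_exponent s s' E : s <= s' ->
  (hausdorff_measure s' E <= hausdorff_measure s E)%E.
Proof.
move=> ss'; apply: ge_ereal_sup => _ [rho /= r0 <-].
apply: (@le_trans _ _ (hausdorff_premeasure s' (Num.min rho 1) E)).
  by apply: hausdorff_premeasure_le; rewrite ge_min lexx.
apply: (@le_trans _ _ (hausdorff_premeasure s (Num.min rho 1) E)).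
  by apply: hausdorff_premeasure_le_exponent => //; rewrite ge_min lexx orbT.
apply: ereal_sup_ubound; exists (Num.min rho 1) => //=.
by rewrite lt_min r0 ltr01.
Qed.

Lemma hausdorff_measure_pinfty_exponent s s' E : s <= s' ->
  hausdorff_measure s' E = +oo%E -> hausdorff_measure s E = +oo%E.
Proof.
move=> ss' h; apply/eqP; rewrite -leye_eq -h.
exact: hausdorff_measure_le_exponent.
Qed.

Lemma hausdorff_dim_ge s E : hausdorff_measure s E = +oo%E ->
  (s%:E <= hausdorff_dim E)%E.
Proof.
move=> h; apply: le_ereal_inf_tmp => _ [s' [s'0 h'] <-].
rewrite lee_fin leNgt; apply/negP => /ltW s's.
by move: h'; rewrite (hausdorff_measure_pinfty_exponent s's h).
Qed.

Lemma hausdorff_dim_ge0 E : (0 <= hausdorff_dim E)%E.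
Proof. by apply: le_ereal_inf_tmp => _ [s' [s'0 h'] <-]; rewrite lee_fin. Qed.

Lemma hausdorff_measure_eq0 s E :
  (forall rho e : R, 0 < rho -> 0 < e -> exists U : nat -> nat -> set V,
    [/\ E `<=` [set x | exists k j, U k j x],
        forall k j, (diam (U k j) <= rho%:E)%E &
        (\sum_(0 <= k <oo) \sum_(0 <= j <oo) hgauge s (U k j) <= e%:E)%E]) ->
  hausdorff_measure s E = 0%E.
Proof.
move=> h; apply/eqP; rewrite eq_le; apply/andP; split; last first.
  apply: (@le_trans _ _ (hausdorff_premeasure s 1 E)).
    exact: hausdorff_premeasure_ge0.
  by apply: ereal_sup_ubound; exists 1 => //=.
apply: ge_ereal_sup => _ [rho /= rho0 <-].
apply/lee_addgt0Pr => e e0; rewrite add0e.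
have [U [EU dU sU]] := h rho e rho0 e0.
have /card_set_bijP[f bf] : ([set: nat] #= [set: nat * nat])%card.
  by rewrite card_eq_sym; exact: card_nat2.
apply: (@le_trans _ _ (\sum_(0 <= i <oo) hgauge s (U (f i).1 (f i).2))%E).
  apply: ereal_inf_lbound; exists (fun i => U (f i).1 (f i).2) => //; split=> //.
  move=> x /EU[k [j Ux]].
  have [i _ fi] := set_bij_surj bf (I : [set: nat * nat] (k, j)).
  by exists i => //; rewrite fi.
apply: le_trans sU.
rewrite nneseries_esumT; last by move=> n; exact: hgauge_ge0.
rewrite -(reindex_esum [set: nat] [set: nat * nat] f
  (fun p => hgauge s (U p.1 p.2))) //.
rewrite nneseries_esumT; last first.
  by move=> n; apply: nneseries_ge0 => *; exact: hgauge_ge0.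
rewrite (eq_esum (b := fun k => \esum_(j in [set: nat]) hgauge s (U k j))).
  rewrite (esum_esum (J := fun=> [set: nat])); last by move=> *; exact: hgauge_ge0.
  rewrite (_ : [set: nat * nat] = [set: nat] `*`` (fun=> [set: nat])) //.
  by apply/seteqP; split=> -[a b].
by move=> k _; rewrite nneseries_esumT// => n; exact: hgauge_ge0.
Qed.

End Hausdorff.
(** * Limsup sets of infinite measure *)

Section Nets.
Context {R : realType} {V : normedModType R}.
Implicit Types (K X : set V) (c : R).

Lemma ballP (x : V) (r : R) y : ball x r y <-> `|x - y| < r.
Proof. by rewrite -ball_normE. Qed.

Lemma compact_separated_bound K c : compact K -> 0 < c ->
  exists N : nat, forall (n : nat) (x : nat -> V),
    (forall i, (i < n)%N -> K (x i)) ->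
    (forall i j, (i < j < n)%N -> c <= `|x i - x j|) -> (n <= N)%N.
Proof.
rewrite compact_cover => cK c0.
have [z _|y Ky|D _ KD] := cK _ K (fun z => ball z (c / 2)).
- exact: ball_open.
- by exists y => //; apply: ballxx; rewrite divr_gt0.
exists (size (finmap.enum_fset D)) => n x Kx sx.
have /choice[f fP] : forall i, exists z, (i < n)%N -> z \in D /\ ball z (c / 2) (x i).
  move=> i; have [ni|ni] := ltnP i n; last by exists 0.
  by have [z zD zi] := KD _ (Kx _ ni); exists z.
rewrite -(size_iota 0 n) -(size_map f); apply: uniq_leq_size; last first.
  by move=> z /mapP[i]; rewrite mem_iota add0n => /andP[_ /fP[fD _]] ->.
rewrite map_inj_in_uniq ?iota_uniq// => i j.
rewrite !mem_iota !add0n => /andP[_ ni] /andP[_ nj] fij.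
have dl : forall i j, (i < j < n)%N -> f i = f j -> False.
  move=> {ni nj fij} {}i {}j /andP[ij jn] fij.
  have [_ /ballP bi] := fP _ (ltn_trans ij jn).
  have [_ /ballP bj] := fP _ jn.
  have := sx i j; rewrite ij jn => /(_ isT).
  rewrite leNgt => /negP; apply.
  rewrite (_ : x i - x j = (f j - x j) - (f i - x i)); last first.
    by rewrite fij opprB [RHS]addrC addrA subrK.
  apply: le_lt_trans (ler_normB _ _) _.
  by rewrite (splitr c) ltrD.
by have [ij|ij|//] := ltngtP i j; exfalso;
   [apply: (dl i j) | apply: (dl j i)]; rewrite ?ij ?ni ?nj.
Qed.

Lemma compact_net K X c : compact K -> X `<=` K -> 0 < c ->
  exists (n : nat) (x : nat -> V),
    [/\ forall i, (i < n)%N -> X (x i),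
        forall i j, (i < j < n)%N -> c <= `|x i - x j| &
        forall y, X y -> exists2 i, (i < n)%N & ball (x i) c y].
Proof.
move=> cK XK c0; have [N hN] := compact_separated_bound cK c0.
apply: contrapT => no.
suff H : forall n, exists x : nat -> V, (forall i, (i < n)%N -> X (x i)) /\
    (forall i j, (i < j < n)%N -> c <= `|x i - x j|).
  have [x [Xx sx]] := H N.+1.
  by have := hN _ _ (fun i h => XK _ (Xx i h)) sx; rewrite ltnn.
elim=> [|n [x [Xx sx]]]; first by exists (fun=> 0); split=> // i j; rewrite ltn0 andbF.
have [y [Xy yx]] : exists y, X y /\ forall i, (i < n)%N -> c <= `|x i - y|.
  apply: contrapT => h; apply: no; exists n, x; split=> // y Xy.
  apply: contrapT => h'; apply: h; exists y; split=> // i ni.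
  rewrite leNgt; apply/negP => b; apply: h'; exists i => //.
  exact/ballP.
exists (fun i => if i == n then y else x i); split=> [i|i j].
  rewrite ltnS leq_eqVlt; case: eqP => //= _; exact: Xx.
rewrite ltnS => /andP[ij jn].
have ni : (i < n)%N := leq_trans ij jn.
rewrite (ltn_eqF ni); case: eqP => [_|/eqP jN]; first exact: yx.
by apply: sx; rewrite ij ltn_neqAle jN.
Qed.

End Nets.

Section Contents.
Context {R : realType} {V : normedModType R}.
Implicit Types (A B X : set V) (nu : set V -> R) (F : nat -> set V).

Definition borel A := measurable (A : set (g_sigma_algebraType (@open V))).

Lemma borel_open A : open A -> borel A.
Proof. exact: sub_sigma_algebra. Qed.

Lemma borel_ball (x : V) (r : R) : borel (ball x r).
Proof.
have [r0|r0] := ltP 0 r; first by apply: borel_open; exact: ball_open.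
rewrite (_ : ball x r = set0); first exact: measurable0.
apply/seteqP; split=> // y /ballP; rewrite ltNge => /negP; apply.
exact: le_trans r0 (normr_ge0 _).
Qed.

Lemma borelT : borel setT.
Proof. exact: measurableT. Qed.

Lemma borelI A B : borel A -> borel B -> borel (A `&` B).
Proof. exact: measurableI. Qed.

Lemma borelU A B : borel A -> borel B -> borel (A `|` B).
Proof. exact: measurableU. Qed.

Lemma borelD A B : borel A -> borel B -> borel (A `\` B).
Proof. exact: measurableD. Qed.

Lemma borelC A : borel A -> borel (~` A).
Proof. exact: measurableC. Qed.

Lemma borel_bigsetU n F : (forall i, (i < n)%N -> borel (F i)) ->
  borel (\big[setU/set0]_(i < n) F i).
Proof.
by move=> mF; apply: (@bigsetU_measurable _ (g_sigma_algebraType (@open V)))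
  => i _; exact: mF.
Qed.

(* A nonnegative set function is only required to be finitely additive, which
   spares constructing a limit measure. *)
Definition is_content nu := (forall A, 0 <= nu A) /\
  (forall A B, borel A -> borel B -> A `&` B = set0 -> nu (A `|` B) = nu A + nu B).

Section Basic.
Variables (nu : set V -> R) (cnu : is_content nu).

Lemma content_set0 : nu set0 = 0.
Proof.
have := cnu.2 set0 set0 measurable0 measurable0; rewrite set0U set0I => /(_ erefl) h.
by apply: (addrI (nu set0)); rewrite -h addr0.
Qed.

Lemma content_le A B : borel A -> borel B -> A `<=` B -> nu A <= nu B.
Proof.
move=> bA bB AB; rewrite -(setDUK AB) cnu.2//; last by rewrite setDIK.
  by rewrite lerDl cnu.1.
exact: borelD.
Qed.

Lemma content_leU A B : borel A -> borel B -> nu (A `|` B) <= nu A + nu B.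
Proof.
move=> bA bB; have -> : A `|` B = A `|` (B `\` A) by rewrite setDE setUIr setUv setIT.
rewrite cnu.2//; last by rewrite setDIK.
- by rewrite lerD2l; apply: content_le => //; exact: borelD.
- exact: borelD.
Qed.

Lemma content_le_bigsetU n F : (forall i, (i < n)%N -> borel (F i)) ->
  nu (\big[setU/set0]_(i < n) F i) <= \sum_(i < n) nu (F i).
Proof.
elim: n => [|n IH] bF; first by rewrite !big_ord0 content_set0.
have bF' i : (i < n)%N -> borel (F i) by move=> ni; apply: bF; exact: ltnW.
rewrite !big_ord_recr /=.
apply: le_trans (content_leU (borel_bigsetU bF') (bF _ (ltnSn n))) _.
by rewrite lerD2r IH.
Qed.

Lemma content_bigsetU n F : (forall i, (i < n)%N -> borel (F i)) ->
  (forall i j, (i < j < n)%N -> F i `&` F j = set0) ->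
  nu (\big[setU/set0]_(i < n) F i) = \sum_(i < n) nu (F i).
Proof.
elim: n => [|n IH] bF dF; first by rewrite !big_ord0 content_set0.
have bF' i : (i < n)%N -> borel (F i) by move=> ni; apply: bF; exact: ltnW.
rewrite !big_ord_recr /= cnu.2 ?IH//.
- by move=> i j /andP[ij jn]; apply: dF; rewrite ij ltnW.
- exact: (borel_bigsetU bF').
- exact: (bF _ (ltnSn n)).
- rewrite -bigcup_mkord setI_bigcupl; apply: bigcup0 => i ni.
  by apply: dF; rewrite ni ltnSn.
Qed.

Lemma is_content_restr B : borel B -> is_content (fun A => nu (A `&` B)).
Proof.
move=> bB; split=> [A|A A' bA bA' AA']; first exact: cnu.1.
rewrite setIUl cnu.2; [by []|exact: borelI|exact: borelI|].
by rewrite setIACA AA' set0I.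
Qed.

Lemma is_content_scale (k : R) : 0 <= k -> is_content (fun A => k * nu A).
Proof.
move=> k0; split=> [A|A A' bA bA' AA']; first by rewrite mulr_ge0 ?cnu.1.
by rewrite cnu.2// mulrDr.
Qed.

End Basic.

Lemma is_content0 : is_content (fun _ => 0).
Proof. by split=> // A B _ _ _; rewrite addr0. Qed.

Lemma is_contentD nu nu' : is_content nu -> is_content nu' ->
  is_content (fun A => nu A + nu' A).
Proof.
move=> c c'; split=> [A|A A' bA bA' AA']; first by rewrite addr_ge0 ?c.1 ?c'.1.
by rewrite c.2// c'.2// addrACA.
Qed.

Lemma is_content_sum n (nu : nat -> set V -> R) :
  (forall i, is_content (nu i)) -> is_content (fun A => \sum_(i < n) nu i A).
Proof.
move=> c; split=> [A|A A' bA bA' AA']; first by apply: sumr_ge0 => i _; exact: (c i).1.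
by rewrite -big_split; apply: eq_bigr => i _; exact: (c i).2.
Qed.

End Contents.
Section PowerBounds.
Context {R : realType}.
Implicit Types (r p q e D : R).

Lemma powR_le_base p x y : 0 <= p -> 0 <= x -> x <= y -> x `^ p <= y `^ p :> R.
Proof.
by move=> p0 x0 xy; apply: ge0_ler_powR; rewrite ?nnegrE// (le_trans x0).
Qed.

Lemma powR_addr r p q : 0 < r -> r `^ (p + q) = r `^ p * r `^ q.
Proof. by move=> r0; apply: powRD; rewrite (gt_eqF r0) implybT. Qed.

Lemma powR_invrK p x : 0 < p -> 0 <= x -> (x `^ p^-1) `^ p = x.
Proof. by move=> p0 x0; rewrite -powRrM mulVf ?powRr1// gt_eqF. Qed.

Lemma small_powR p e D : 0 < p -> 0 < e -> 0 <= D ->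
  exists r0, [/\ 0 < r0, r0 <= 1 & forall r, 0 < r -> r <= r0 -> D * r `^ p <= e].
Proof.
move=> p0 e0 D0; have D1 : 0 < D + 1 by rewrite ltr_wpDl.
have q0 : 0 < e / (D + 1) by rewrite divr_gt0.
exists (Num.min 1 ((e / (D + 1)) `^ p^-1)).
rewrite lt_min ltr01 powR_gt0//= ge_min lexx; split=> // r r0.
rewrite le_min => /andP[_ /(powR_le_base (ltW p0) (ltW r0))].
rewrite powR_invrK ?(ltW q0)// => h.
apply: (@le_trans _ _ ((D + 1) * r `^ p)).
  by rewrite ler_wpM2r ?powR_ge0// lerDl.
by rewrite mulrC -ler_pdivlMr.
Qed.

End PowerBounds.

Section MassDistribution.
Context {R : realType} {V : normedModType R}.
Variables (K : set V) (s delta C : R).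
Hypotheses (sdelta : s < delta) (C0 : 0 < C).
Variables (h : nat -> set V -> R) (E : nat -> set V).
Hypothesis ch : forall n, is_content (h n).
Hypothesis h_supp : forall n A, borel A -> A `&` E n = set0 -> h n A = 0.
Hypothesis h_large : forall w : R, 0 < w -> exists n0, forall n, (n0 <= n)%N ->
  forall x (r : R), K x -> w <= r -> r <= 1 ->
  C^-1 * r `^ delta <= h n (ball x r) <= C * r `^ delta.
Hypothesis h_le : forall n x (r : R), K x -> 0 < r -> r <= 1 ->
  h n (ball x r) <= C * r `^ s.
Hypothesis h_small : forall n, exists2 D : R, 0 <= D &
  forall x (r : R), K x -> 0 < r -> r <= 1 -> h n (ball x r) <= D * r `^ delta.

Let powdelta r : 0 < r -> r `^ delta = r `^ (delta - s) * r `^ s.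
Proof. by move=> r0; rewrite -powR_addr// subrK. Qed.

(* At a given radius at most one summand is in the range where only [h_le]
   is available: the indices are chosen one after the other, far apart. *)
Lemma sum_sparse (m : nat) (w e : R) (n0 : nat) : 0 < w -> 0 < e ->
  exists (lam : set V -> R) (D : R) (N : nat),
  [/\ is_content lam,
      forall A, borel A -> (forall n, (n0 <= n < N)%N -> A `&` E n = set0) ->
        lam A = 0,
      0 <= D &
      forall x (r : R), K x -> 0 < r -> r <= 1 ->
      [/\ lam (ball x r) <= D * r `^ delta,
          lam (ball x r) <= m%:R * C * r `^ delta + (m%:R * e + C) * r `^ s &
          w <= r -> m%:R * C^-1 * r `^ delta <= lam (ball x r)]].
Proof.
move=> w0 e0; elim: m => [|m [lam [D [N [clam slam D0 blam]]]]].
  exists (fun=> 0), 0, 0%N; split=> //; first exact: is_content0.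
  move=> x r _ r0 _; rewrite !mul0r !add0r; split=> //.
  by rewrite mulr_ge0 ?powR_ge0 ?ltW.
have ds : 0 < delta - s by rewrite subr_gt0.
have [r1 [r10 r11 hr1]] := small_powR ds e0 D0.
have [n1 hn1] : exists n1, forall n, (n1 <= n)%N -> forall x (r : R), K x ->
    Num.min w r1 <= r -> r <= 1 ->
    C^-1 * r `^ delta <= h n (ball x r) <= C * r `^ delta.
  by apply: h_large; rewrite lt_min w0.
pose n := maxn n0 n1; have [Dn Dn0 hDn] := h_small n.
exists (fun A => lam A + h n A), (D + Dn), (maxn N n.+1); split.
- exact: is_contentD.
- move=> A bA h0; rewrite slam//; last first.
    move=> k /andP[n0k kN]; apply: h0.
    by rewrite n0k /= (leq_trans kN)// leq_maxl.
  rewrite add0r h_supp//; apply: h0.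
  by rewrite leq_maxl /= leq_maxr.
- exact: addr_ge0.
- move=> x r Kx r0 r1'; have [b1 b2 b3] := blam x r Kx r0 r1'.
  have bn := hDn x r Kx r0 r1'; split.
  + by rewrite mulrDl lerD.
  + have rs0 : 0 <= r `^ s by exact: powR_ge0.
    have rd0 : 0 <= r `^ delta by exact: powR_ge0.
    have m0 : 0 <= m%:R :> R by [].
    have [wr|rw] := leP (Num.min w r1) r.
      have /andP[_ u] := hn1 n (leq_maxr _ _) x r Kx wr r1'.
      apply: le_trans (lerD b2 u) _; rewrite -natr1.
      have : 0 <= e * r `^ s by rewrite mulr_ge0 // ltW.
      nra.
    have rr1 : r <= r1 by move: rw; rewrite lt_min => /andP[_ /ltW].
    have b4 : lam (ball x r) <= e * r `^ s.
      by apply: le_trans b1 _; rewrite powdelta// mulrA ler_wpM2r// hr1.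
    apply: le_trans (lerD b4 (h_le n Kx r0 r1')) _; rewrite -natr1.
    have : 0 <= e * r `^ s by rewrite mulr_ge0 // ltW.
    have : 0 <= m%:R * C * r `^ delta by rewrite !mulr_ge0 // ltW.
    have : 0 <= m%:R * e * r `^ s by rewrite !mulr_ge0 // ltW.
    have : 0 <= C * r `^ delta by rewrite !mulr_ge0 // ltW.
    nra.
  + move=> wr; rewrite -natr1 !mulrDl mul1r lerD ?b3//.
    have := hn1 n (leq_maxr _ _) x r Kx.
    by rewrite ge_min wr => /(_ isT r1') /andP[].
Qed.

Lemma average_sparse (w e : R) (n0 : nat) : 0 < w -> 0 < e ->
  exists (lam : set V -> R) (D : R) (N : nat),
  [/\ is_content lam,
      forall A, borel A -> (forall n, (n0 <= n < N)%N -> A `&` E n = set0) ->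
        lam A = 0,
      0 <= D &
      forall x (r : R), K x -> 0 < r -> r <= 1 ->
      [/\ lam (ball x r) <= D * r `^ delta,
          lam (ball x r) <= C * r `^ delta + e * r `^ s &
          w <= r -> C^-1 * r `^ delta <= lam (ball x r)]].
Proof.
move=> w0 e0; have e20 : 0 < e / 2 by rewrite divr_gt0.
pose m := (Num.truncn (C / (e / 2))).+1.
have m0 : 0 < m%:R :> R by rewrite ltr0n.
have mC : C <= m%:R * (e / 2).
  by rewrite -ler_pdivrMr//; apply/ltW/truncnS_gt.
have [lam [D [N [clam slam D0 blam]]]] := sum_sparse m n0 w0 e20.
exists (fun A => m%:R^-1 * lam A), (m%:R^-1 * D), N; split.
- by apply: is_content_scale => //; rewrite invr_ge0.
- by move=> A bA h0; rewrite slam ?mulr0.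
- by rewrite mulr_ge0 // invr_ge0.
- move=> x r Kx r0 r1; have [b1 b2 b3] := blam x r Kx r0 r1; split.
  + by rewrite -mulrA ler_pM2l// invr_gt0.
  + rewrite ler_pdivrMl//; apply: le_trans b2 _; rewrite mulrDr !mulrA lerD2l.
    by rewrite ler_wpM2r ?powR_ge0//; lra.
  + by move=> wr; rewrite ler_pdivlMl// mulrA b3.
Qed.

End MassDistribution.
Section Transfer.
Context {R : realType} {V : normedModType R}.
Variables (K S : set V) (nu lam : set V -> R) (c M : R).
Hypotheses (cK : compact K) (SK : S `<=` K) (c0 : 0 < c) (M0 : 0 <= M).
Hypotheses (cnu : is_content nu) (clam : is_content lam).
Hypothesis nu_supp : forall A, borel A -> A `&` S = set0 -> nu A = 0.
Hypothesis lam_gt0 : forall x, K x -> 0 < lam (ball x (c / 2)).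
Hypothesis nu_lam : forall x, K x -> nu (ball x c) <= M * lam (ball x (c / 2)).

(* The mass of [nu] near each point of a maximal [c]-separated subset of [K] is
   spread over the ball of radius [c / 2] around it, proportionally to [lam]. *)
Lemma transfer : exists nu' : set V -> R,
  [/\ is_content nu',
      nu' setT = nu setT,
      forall A, borel A -> nu' A <= M * lam A,
      forall x r, nu' (ball x r) <= nu (ball x (r + 2 * c)) &
      forall A, borel A -> lam (A `&` \bigcup_(z in S) ball z (2 * c)) = 0 ->
        nu' A = 0].
Proof.
have [n [x [Kx sx netx]]] := compact_net cK (@subset_refl _ K) c0.
pose F i := ball (x i) c; pose W i := seqDU F i; pose B i := ball (x i) (c / 2).
have bF i : borel (F i) by exact: borel_ball.
have bB i : borel (B i) by exact: borel_ball.
have bW i : borel (W i) by apply: borelD => //; exact: borel_bigsetU.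
have dW i j : (i < j)%N -> W i `&` W j = set0.
  move=> ij; have /trivIsetP/(_ i j) := @trivIset_seqDU _ F.
  by apply=> //; rewrite neq_ltn ij.
have WF i y : W i y -> F i y by move=> [].
have nuW i : (i < n)%N -> nu (W i) <= M * lam (B i).
  move=> ni; apply: le_trans (nu_lam (Kx _ ni)).
  by apply: (content_le cnu (bW i) (bF i)) => y /WF.
have lB i : (i < n)%N -> 0 < lam (B i) by move=> ni; exact: lam_gt0 (Kx _ ni).
have k0 i : 0 <= nu (W i) / lam (B i) by rewrite divr_ge0 ?cnu.1 ?clam.1.
exists (fun A => \sum_(i < n) nu (W i) / lam (B i) * lam (A `&` B i)); split.
- apply: (@is_content_sum _ _ n (fun i A => nu (W i) / lam (B i) * lam (A `&` B i))).
  by move=> i; apply: is_content_scale => //; exact: is_content_restr.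
- transitivity (\sum_(i < n) nu (W i)).
    apply: eq_bigr => i _; rewrite setTI divfK// gt_eqF//.
    exact: lB.
  rewrite -(content_bigsetU cnu (F := W))//; last by move=> i j /andP[/dW].
  rewrite -bigsetU_seqDU; set U := \big[_/_]_(_ < _) _.
  have bU : borel U by exact: borel_bigsetU.
  have bUC : borel (~` U) by exact: borelC.
  rewrite -[setT](setUv U) cnu.2//; last exact: setICr.
  rewrite (nu_supp bUC) ?addr0//.
  apply/seteqP; split=> // y [Uy /SK/netx[i ni Fy]]; apply: Uy.
  by rewrite /U -bigcup_mkord; exists i.
- move=> A bA; apply: (@le_trans _ _ (M * \sum_(i < n) lam (A `&` B i))).
    rewrite mulr_sumr; apply: ler_sum => i _.
    by rewrite ler_wpM2r ?clam.1// ler_pdivrMr ?nuW// lB.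
  have bAB i : borel (A `&` B i) := borelI bA (bB i).
  rewrite ler_wpM2l// -(content_bigsetU clam (F := fun i => A `&` B i))//.
  + apply: (content_le clam (borel_bigsetU (F := fun i => A `&` B i) (fun i _ => bAB i)) bA).
    by rewrite -(bigcup_mkord n (fun i => A `&` B i)) => y [i _ []].
  + move=> i j ijn; apply/seteqP; split=> // y [[_ /ballP yi] [_ /ballP yj]].
    have := sx i j ijn; rewrite leNgt => /negP; apply.
    by rewrite (splitr c) -(subrKA y); apply: le_lt_trans (ler_normD _ _) _;
      rewrite ltrD// distrC.
- move=> z r; pose G i := if `[< ball z r `&` B i = set0 >] then set0 else W i.
  have bG i : borel (G i).
    by rewrite /G; case: ifP => // _; exact: measurable0.
  have GW i y : G i y -> W i y by rewrite /G; case: ifP.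
  apply: (@le_trans _ _ (\sum_(i < n) nu (G i))).
    apply: ler_sum => i _; rewrite /G; case: asboolP => [->|_].
      by rewrite content_set0// mulr0 cnu.1.
    rewrite -[leRHS](divfK (lt0r_neq0 (lB i (ltn_ord i)))) ler_wpM2l//.
    exact: (content_le clam (borelI (borel_ball _ _) (bB i)) (bB i)).
  rewrite -(content_bigsetU cnu (F := G))//; last first.
    move=> i j /andP[ij _]; apply/seteqP; split=> // y [/GW yi /GW yj].
    by rewrite -(dW i j ij).
  apply: (content_le cnu (borel_bigsetU (F := G) (fun i _ => bG i)) (borel_ball _ _)).
  rewrite -bigcup_mkord => y [i _]; rewrite /G; case: asboolP => // h0.
  move=> /WF /ballP xy.
  have /set0P[t [/ballP zt /ballP xt]] : ball z r `&` B i != set0 by apply/eqP.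
  apply/ballP; rewrite -(subrKA t) -(subrKA (x i) t).
  apply: le_lt_trans (ler_normD _ _) _; rewrite ltrD//.
  apply: le_lt_trans (ler_normD _ _) _.
  rewrite distrC in xt; have := c0; lra.
- move=> A bA; set U := \bigcup_(_ in _) _ => l0.
  have bU : borel U.
    by apply: borel_open; apply: bigcup_open => t _; apply: ball_open; rewrite mulr_gt0.
  apply: big1 => i _.
  have [WS|/set0P[t [Wt St]]] := eqVneq (W i `&` S) set0.
    by rewrite nu_supp ?mul0r.
  rewrite (_ : lam (A `&` B i) = 0) ?mulr0//; apply/eqP.
  rewrite eq_le clam.1 andbT -l0.
  apply: (content_le clam (borelI bA (bB i)) (borelI bA bU)).
  move=> y [Ay /ballP xy]; split=> //; exists t => //.
  move/WF/ballP: Wt => xt; apply/ballP; rewrite -(subrKA (x i)).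
  apply: le_lt_trans (ler_normD _ _) _; rewrite distrC; have := c0; lra.
Qed.

End Transfer.
Section NestedMass.
Context {R : realType} {V : normedModType R}.
Implicit Types (K X : set V).

Lemma compact_nested K (Z : nat -> set V) : compact K -> (forall n, closed (Z n)) ->
  (forall n, Z n.+1 `<=` Z n) -> (forall n, exists2 x, K x & Z n x) ->
  exists2 x, K x & forall n, Z n x.
Proof.
rewrite compact_In0 => cK cZ dZ ZN.
have dZ' m n : (n <= m)%N -> Z m `<=` Z n.
  elim: m => [|m IH]; first by rewrite leqn0 => /eqP ->.
  rewrite leq_eqVlt ltnS => /orP[/eqP -> //|/IH h]; exact: subset_trans (dZ m) h.
have [||x xP] := cK nat setT (fun n => K `&` Z n).
- by exists Z.
- move=> D' _; have [x Kx Zx] := ZN (\max_(i <- D') i)%N.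
  exists x => i /= iD'; split=> //; apply: (dZ' _ _ _ _ Zx).
  exact: (@leq_bigmax_seq _ _ xpredT (fun i => i)).
by exists x; [have [] := xP 0%N I|move=> n; have [] := xP n I].
Qed.

Lemma nested_mass_premeasure K (s A P : R) (Y : nat -> set V)
    (nu : nat -> set V -> R) X :
  compact K -> 0 < s -> 0 < A -> 0 < P ->
  (forall n, closed (Y n)) -> (forall n, Y n.+1 `<=` Y n) ->
  (forall n, is_content (nu n)) -> (forall n, nu n setT = 1) ->
  (forall n B, borel B -> B `&` (K `&` Y n) = set0 -> nu n B = 0) ->
  (forall n x (r : R), K x -> 0 < r -> r <= P -> nu n (ball x r) <= A * r `^ s) ->
  (forall x, K x -> (forall n, Y n x) -> X x) ->
  (((A^-1 - 1) / 2 `^ s)%:E <= hausdorff_premeasure s (P / 2) X)%E.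
Proof.
move=> cK s0 A0 P0 cY dY cnu nu1 nuY nuA YX.
apply: le_ereal_inf_tmp => _ [U [XU dU] <-].
have /choice[dd ddP] : forall i, exists r : R, diam (U i) = r%:E.
  move=> i; have := dU i; have := diam_ge0 (U i).
  by case: (diam (U i)) => // r _ _; exists r.
have dd0 i : 0 <= dd i by rewrite -lee_fin -ddP diam_ge0.
have ddP2 i : dd i <= P / 2 by rewrite -lee_fin -ddP.
pose p := Num.min P 1.
have p0 : 0 < p by rewrite lt_min P0 ltr01.
have pP : p <= P by rewrite ge_min lexx.
have p1 : p <= 1 by rewrite ge_min lexx orbT.
pose t i := p * (2^-1 ^+ i.+1) `^ s^-1.
have one_pow q : 1 `^ q = 1 :> R by rewrite powR1.
have h0 i : 0 < 2^-1 ^+ i.+1 :> R by rewrite exprn_gt0.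
have t0 i : 0 < t i by rewrite mulr_gt0 ?powR_gt0.
have tP i : t i <= P.
  apply: le_trans pP; rewrite -[leRHS]mulr1 ler_pM2l//.
  rewrite -[leRHS](one_pow s^-1); apply: powR_le_base; rewrite ?invr_ge0 ?ltW//.
  by rewrite exprn_ilte1// ?invr_gt0// invf_lt1// ltr1n.
have ts i : t i `^ s <= 2^-1 ^+ i.+1.
  rewrite /t powRM ?(ltW p0) ?powR_ge0// powR_invrK ?(ltW (h0 i))//.
  rewrite -[leRHS]mul1r ler_pM2r//.
  by rewrite -[leRHS](one_pow s) powR_le_base// ltW.
pose r i := Num.max (2 * dd i) (t i).
have r0 i : 0 < r i by rewrite lt_max t0 orbT.
have rP i : r i <= P.
  by rewrite ge_max tP andbT mulrC -ler_pdivlMr.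
have dr i : dd i < r i.
  rewrite lt_max; have := dd0 i; rewrite le_eqVlt => /orP[/eqP <-|d0].
    by rewrite t0 orbT.
  by rewrite mulr_natl mulr2n ltrDl d0.
have rs i : r i `^ s <= 2 `^ s * dd i `^ s + 2^-1 ^+ i.+1.
  rewrite /r; case: (leP (2 * dd i) (t i)) => _.
    by apply: le_trans (ts i) _; rewrite lerDr mulr_ge0 ?powR_ge0.
  by rewrite powRM// lerDl ltW.
have /choice[b bP] : forall i, exists b : set V, [/\ open b, U i `&` K `<=` b &
    forall n, nu n b <= A * (2 `^ s * fine (hgauge s (U i)) + 2^-1 ^+ i.+1)].
  move=> i; have [UK0|/set0P[x [Ux Kx]]] := eqVneq (U i `&` K) set0.
    exists set0; split; [exact: open0|by rewrite UK0|].
    move=> n; rewrite content_set0//; rewrite mulr_ge0 ?ltW// ltr_wpDl//.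
    by rewrite mulr_ge0 ?powR_ge0 ?fine_ge0 ?hgauge_ge0.
  exists (ball x (r i)); split; first exact: ball_open.
    move=> y [Uy Ky]; apply/ballP; apply: le_lt_trans (dr i).
    by rewrite -lee_fin -ddP dist_le_diam.
  move=> n; apply: le_trans (nuA n x (r i) Kx (r0 i) (rP i)) _.
  rewrite ler_pM2l// /hgauge ddP; case: eqP => [U0|_]; first by rewrite U0 in Ux.
  by rewrite [s < 0]ltNge (ltW s0) /=.
have hfin i : (fine (hgauge s (U i)))%:E = hgauge s (U i).
  by rewrite /hgauge ddP; case: eqP => // _; rewrite [s < 0]ltNge (ltW s0).
pose Z n := Y n `\` \big[setU/set0]_(i < n) b i.
have [n ZN] : exists n, forall x, K x -> ~ Z n x.
  apply: contrapT => no.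
  have [n|n y||x Kx Zx] := @compact_nested K Z cK.
  - apply: closedI => //; apply: open_closedC.
    by rewrite -bigcup_mkord; apply: bigcup_open => i _; have [] := bP i.
  - rewrite /Z big_ord_recr /= => -[/dY Yy nb].
    by split=> // by'; apply: nb; left.
  - move=> n; apply: contrapT => h; apply: no; exists n => x Kx Zx.
    by apply: h; exists x.
  have [i _ Ux] := XU x (YX x Kx (fun n => (Zx n).1)).
  have [_ UKb _] := bP i.
  have [_] := Zx i.+1; apply; rewrite -bigcup_mkord; exists i => /=; first exact: ltnSn.
  by apply: UKb.
pose W := \big[setU/set0]_(i < n) b i.
have bb i : borel (b i) by apply: borel_open; have [] := bP i.
have bW : borel W by apply: borel_bigsetU.
have nW : nu n W = 1.
  have bWC := borelC bW.
  rewrite -(nu1 n) -[in RHS](setUv W) (cnu n).2//; last exact: setICr.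
  rewrite (nuY n (~` W))// ?addr0//.
  by apply/seteqP; split=> // y [nWy [Ky Yy]]; apply: (ZN y Ky).
have sumh : \sum_(i < n) 2^-1 ^+ i.+1 <= 1 :> R.
  rewrite (_ : \sum_(i < n) _ = 1 - 2^-1 ^+ n); first by rewrite gerBl exprn_ge0.
  elim: n {ZN W bW nW} => [|n IH]; first by rewrite big_ord0 expr0 subrr.
  by rewrite big_ord_recr /= IH exprS; field.
have h1 : 1 <= A * (2 `^ s * (\sum_(i < n) fine (hgauge s (U i))) + 1).
  rewrite -[leLHS]nW; apply: le_trans (content_le_bigsetU (cnu n) (fun i _ => bb i)) _.
  apply: (@le_trans _ _
      (\sum_(i < n) A * (2 `^ s * fine (hgauge s (U i)) + 2^-1 ^+ i.+1))).
    by apply: ler_sum => i _; have [_ _] := bP i; apply.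
  by rewrite -mulr_sumr ler_pM2l// big_split /= -mulr_sumr lerD2l.
have h2 : (A^-1 - 1) / 2 `^ s <= \sum_(i < n) fine (hgauge s (U i)).
  by rewrite ler_pdivrMr ?powR_gt0// lerBlDr mulrC -[leLHS]mulr1 ler_pdivrMl.
apply: (@le_trans _ _ (\sum_(i < n) hgauge s (U i))%E).
  rewrite -(eq_bigr _ (fun (i : 'I_n) _ => hfin i)) sumEFin lee_fin; exact: h2.
rewrite -(big_mkord predT (fun i => hgauge s (U i))).
by apply: nneseries_lim_ge => *; exact: hgauge_ge0.
Qed.

End NestedMass.
Section LimsupMeasure.
Context {R : realType} {V : normedModType R}.
Variables (K : set V) (s delta C : R).
Hypotheses (cK : compact K) (s0 : 0 < s) (sdelta : s < delta) (C0 : 0 < C).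
Variables (h : nat -> set V -> R) (E E' : nat -> set V).
Hypotheses (ch : forall n, is_content (h n)) (EK : forall n, E n `<=` K).
Hypothesis h_supp : forall n A, borel A -> A `&` E n = set0 -> h n A = 0.
Hypothesis h_large : forall w : R, 0 < w -> exists n0, forall n, (n0 <= n)%N ->
  forall x (r : R), K x -> w <= r -> r <= 1 ->
  C^-1 * r `^ delta <= h n (ball x r) <= C * r `^ delta.
Hypothesis h_le : forall n x (r : R), K x -> 0 < r -> r <= 1 ->
  h n (ball x r) <= C * r `^ s.
Hypothesis h_small : forall n, exists2 D : R, 0 <= D &
  forall x (r : R), K x -> 0 < r -> r <= 1 -> h n (ball x r) <= D * r `^ delta.
Hypothesis E_thick : forall n, exists2 e : R, 0 < e &
  forall y z, E n y -> `|y - z| < e -> E' n z.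

Lemma refine_mass (nu : set V -> R) (S : set V) (D a a' rho rho' gap : R) (n0 : nat) :
  is_content nu -> S `<=` K -> (forall A, borel A -> A `&` S = set0 -> nu A = 0) ->
  0 <= D -> (forall x (r : R), K x -> 0 < r -> r <= 1 -> nu (ball x r) <= D * r `^ delta) ->
  0 < a -> a < a' -> 0 < rho' -> rho' < rho -> rho <= 1 ->
  (forall x (r : R), K x -> 0 < r -> r <= rho -> nu (ball x r) <= a * r `^ s) ->
  0 < gap ->
  exists (nu' : set V -> R) (S' : set V) (D' : R) (N : nat),
  [/\ is_content nu' /\ nu' setT = nu setT,
      (forall A, borel A -> A `&` S' = set0 -> nu' A = 0),
      0 <= D' /\
        (forall x (r : R), K x -> 0 < r -> r <= 1 -> nu' (ball x r) <= D' * r `^ delta),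
      (forall x (r : R), K x -> 0 < r -> r <= rho' -> nu' (ball x r) <= a' * r `^ s) &
      (forall y, S' y -> (exists2 n, (n0 <= n < N)%N & E n y) /\
         exists2 z, S z & `|z - y| < gap)].
Proof.
move=> cnu SK nuS D0 nuD a0 aa' rho'0 rr' rho1 nua gap0.
have a'0 : 0 < a' by exact: lt_trans aa'.
pose M := D * C * 2 `^ delta.
have M0 : 0 <= M by rewrite !mulr_ge0 ?powR_ge0// ltW.
have s00 : 0 < s := s0.
have ds : 0 < delta - s by rewrite subr_gt0.
have C00 : 0 < C := C0.
(* [q] is chosen so that enlarging a radius by the factor [1 + q] costs at most
   the factor [a' / a]. *)
pose q := (a' / a) `^ s^-1 - 1.
have q0 : 0 < q.
  rewrite subr_gt0 -[ltLHS](_ : 1 `^ s^-1 = 1); last by rewrite powR1.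
  by apply: gt0_ltr_powR; rewrite ?invr_gt0 ?nnegrE ?divr_ge0 ?ltW ?ltr_pdivlMr ?mul1r.
have q1s : (1 + q) `^ s = a' / a.
  by rewrite addrC subrK powR_invrK// divr_ge0// ltW.
pose e := a' / 2 / (M + 1).
have M10 : 0 < M + 1 by rewrite ltr_wpDl.
have e0 : 0 < e by rewrite divr_gt0// divr_gt0.
have MC0 : 0 <= M * C by rewrite mulr_ge0// ltW.
have a'20 : 0 < a' / 2 by rewrite divr_gt0.
have [r0 [r00 r01 hr0]] := small_powR ds a'20 MC0.
have r0q : 0 < r0 * q by rewrite mulr_gt0.
have [c [c0 c1 c2 c3]] : exists c : R, [/\ 0 < c, 2 * c < gap, 2 * c <= rho - rho'
    & 2 * c < r0 * q].
  exists (Num.min (Num.min gap (rho - rho')) (r0 * q) / 4).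
  set m := Num.min _ _; have : m <= gap by rewrite !ge_min lexx.
  have : m <= rho - rho' by rewrite !ge_min lexx orbT.
  have : m <= r0 * q by rewrite !ge_min lexx orbT.
  have : 0 < m by rewrite !lt_min gap0 r0q subr_gt0 rr'.
  by move=> *; split; lra.
have c20 : 0 < c / 2 by rewrite divr_gt0.
have cle1 : c <= 1 by lra.
have c21 : c / 2 <= 1 by lra.
have [lam [Dl [N [clam slam Dl0 blam]]]] :=
  average_sparse sdelta C0 ch h_supp h_large h_le h_small n0 c20 e0.
have lamc x : K x -> C^-1 * (c / 2) `^ delta <= lam (ball x (c / 2)).
  by move=> Kx; have [_ _] := blam x (c / 2) Kx c20 c21; apply.
have lam_gt0 x : K x -> 0 < lam (ball x (c / 2)).
  by move=> /lamc; apply: lt_le_trans; rewrite mulr_gt0 ?invr_gt0 ?powR_gt0.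
have nulam x : K x -> nu (ball x c) <= M * lam (ball x (c / 2)).
  move=> Kx; apply: le_trans (nuD x c Kx c0 cle1) _.
  apply: (@le_trans _ _ (M * (C^-1 * (c / 2) `^ delta))); last first.
    by rewrite ler_wpM2l// lamc.
  rewrite /M -!mulrA ler_wpM2l// [X in C * X]mulrCA mulVKf ?gt_eqF//.
  by rewrite -powRM ?(ltW c20)// mulrC divfK.
have [nu' [cnu' nu'T nu'M nu'b nu'S]] :=
  transfer cK SK c0 M0 cnu clam nuS lam_gt0 nulam.
pose S' := [set y | exists2 n, (n0 <= n < N)%N & E n y] `&`
  \bigcup_(z in S) ball z (2 * c).
exists nu', S', (M * Dl), N; split=> //.
- move=> A bA AS; apply: nu'S => //; apply: slam.
    apply: borelI => //; apply: borel_open; apply: bigcup_open => z _.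
    by apply: ball_open; rewrite mulr_gt0.
  move=> n nN; apply/seteqP; split=> // y [[Ay Sy] Ey].
  by rewrite -AS; split=> //; split=> //; exists n.
- split; first exact: mulr_ge0.
  move=> x r Kx rr0 r1; have [b1 _ _] := blam x r Kx rr0 r1.
  apply: le_trans (nu'M _ (borel_ball _ _)) _.
  by rewrite -mulrA ler_wpM2l.
- move=> x r Kx rr0 rr; have r1 : r <= 1 by lra.
  have rs0 : 0 <= r `^ s by exact: powR_ge0.
  have [rge|rlt] := leP (2 * c / q) r.
    apply: le_trans (nu'b x r) _.
    have rc0 : 0 < r + 2 * c by rewrite addr_gt0// mulr_gt0.
    apply: le_trans (nua x _ Kx rc0 _) _; first by lra.
    rewrite -ler_pdivlMl// mulrA [_^-1 * _]mulrC -q1s -powRM ?(ltW rr0)//; last by lra.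
    apply: powR_le_base; rewrite ?(ltW s0) ?(ltW rc0)//.
    by rewrite [leRHS]mulrDl mul1r lerD2l [leRHS]mulrC -ler_pdivrMr.
  have rr00 : r <= r0.
    by apply: ltW; apply: lt_trans rlt _; rewrite ltr_pdivrMr.
  apply: le_trans (nu'M _ (borel_ball _ _)) _.
  have [_ b2 _] := blam x r Kx rr0 r1.
  apply: le_trans (ler_wpM2l M0 b2) _.
  rewrite mulrDr mulrA -[delta](subrK s) powR_addr// mulrA [leRHS](_ : _ =
    a' / 2 * r `^ s + a' / 2 * r `^ s); last by lra.
  apply: lerD; first by rewrite ler_wpM2r// hr0.
  rewrite mulrA ler_wpM2r// /e mulrA ler_pdivrMr// mulrC ler_wpM2l ?(ltW a'20)//.
  by rewrite lerDl.
- move=> y [En [z Sz /ballP zy]]; split=> //; exists z => //; exact: lt_trans zy _.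
Qed.

Lemma uniform_thickness N : exists2 e : R, 0 < e &
  forall n y z, (n < N)%N -> E n y -> `|y - z| < e -> E' n z.
Proof.
elim: N => [|N [e e0 IH]]; first by exists 1.
have [e' e'0 h'] := E_thick N; exists (Num.min e e'); first by rewrite lt_min e0.
move=> n y z; rewrite ltnS leq_eqVlt lt_min => /orP[/eqP ->|nN] Ey /andP[h1 h2].
  exact: h' Ey h2.
exact: IH Ey h1.
Qed.

Record stage := Stage {
  stage_mass : set V -> R; stage_supp : set V; stage_gap : R;
  stage_const : R; stage_radius : R; stage_level : nat }.

Definition stage_nbhd (x : stage) : set V :=
  closure (\bigcup_(z in stage_supp x) ball z (stage_gap x)).

Definition good_stage (A P : R) (x : stage) : Prop :=
  [/\ is_content (stage_mass x) /\ stage_mass x setT = 1,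
      stage_supp x `<=` K /\
        (forall B, borel B -> B `&` stage_supp x = set0 -> stage_mass x B = 0),
      exists2 D : R, 0 <= D & forall y (r : R), K y -> 0 < r -> r <= 1 ->
        stage_mass x (ball y r) <= D * r `^ delta,
      forall y (r : R), K y -> 0 < r -> r <= stage_radius x ->
        stage_mass x (ball y r) <= stage_const x * r `^ s &
      [/\ 0 < stage_const x, stage_const x < A, P < stage_radius x,
          stage_radius x <= 1 & 0 < stage_gap x]].

Definition next_stage (A P : R) (x x' : stage) : Prop :=
  good_stage A P x -> [/\ good_stage A P x', stage_nbhd x' `<=` stage_nbhd x,
    stage_level x' = (stage_level x).+1 &
    forall y, stage_nbhd x' y -> exists2 n, (stage_level x <= n)%N & E' n y].

Lemma next_stage_exists (A P : R) (x : stage) : 0 < P ->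
  exists x', next_stage A P x x'.
Proof.
move=> P0; have [gx|] := pselect (good_stage A P x); last by exists x.
have [[cx x1] [xK xS] [D D0 xD] xa [c0 cA Pr r1 g0]] := gx.
pose a' := (stage_const x + A) / 2; pose r' := (P + stage_radius x) / 2.
have [ca' a'A] : stage_const x < a' /\ a' < A by rewrite /a'; split; lra.
have [Pr' r'r] : P < r' /\ r' < stage_radius x by rewrite /r'; split; lra.
have r'0 : 0 < r' by exact: lt_trans Pr'.
have g20 : 0 < stage_gap x / 2 by rewrite divr_gt0.
have [nu [S [D' [N [[cnu nu1] nuS [D'0 nuD] nua SE]]]]] :=
  refine_mass (stage_level x) cx xK xS D0 xD c0 ca' r'0 r'r r1 xa g20.
have [e e0 he] := uniform_thickness N.
pose g' := Num.min (stage_gap x) e / 2.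
have [g'0 g'g g'e] : [/\ 0 < g', g' <= stage_gap x / 2 & 2 * g' <= e].
  rewrite /g'; set m := Num.min _ _.
  have : 0 < m by rewrite lt_min g0.
  have : m <= stage_gap x by rewrite ge_min lexx.
  have : m <= e by rewrite ge_min lexx orbT.
  by move=> *; split; lra.
exists (Stage nu S g' a' r' (stage_level x).+1) => _; split => //=.
- split=> //=; first by rewrite nu1.
  + by split=> // y /SE[[n _ /EK]].
  + by exists D'.
  + split=> //; lra.
- apply: closure_subset => y [z /SE[_ [t St tz]] /ballP zy].
  exists t => //; apply/ballP; rewrite -(subrKA z).
  apply: le_lt_trans (ler_normD _ _) _; rewrite (splitr (stage_gap x)) ltrD//.
  exact: lt_le_trans zy _.
- move=> y /(_ (ball y g'))[|z [[t /SE[[n /andP[ln nN] Et] _] /ballP tz] /ballP yz]].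
    exact: nbhsx_ballx.
  exists n => //; apply: (he n t) => //; rewrite -(subrKA z).
  apply: le_lt_trans (ler_normD _ _) _; apply: lt_le_trans g'e.
  by rewrite mulr_natl mulr2n ltrD// distrC.
Qed.

Lemma hausdorff_measure_limsup (mu0 : set V -> R) (X : set V) :
  is_content mu0 -> mu0 setT = 1 ->
  (forall B, borel B -> B `&` K = set0 -> mu0 B = 0) ->
  (forall x (r : R), K x -> 0 < r -> r <= 1 -> mu0 (ball x r) <= C * r `^ delta) ->
  (forall x, K x -> (forall N, exists2 n, (N <= n)%N & E' n x) -> X x) ->
  hausdorff_measure s X = +oo%E.
Proof.
move=> cmu mu1 muK muC XE.
suff key (A : R) : 0 < A -> exists2 P : R, 0 < P &
    (((A^-1 - 1) / 2 `^ s)%:E <= hausdorff_premeasure s P X)%E.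
  apply/eqyP => M M0; have p0 : 0 < 2 `^ s :> R by rewrite powR_gt0.
  have [|P P0] := key (M * 2 `^ s + 1)^-1; first by rewrite invr_gt0 addr_gt0// mulr_gt0.
  rewrite invrK addrK mulfK ?gt_eqF// => /le_trans; apply.
  by apply: ereal_sup_ubound; exists P.
move=> A0; have ds : 0 < delta - s by rewrite subr_gt0.
have A20 : 0 < A / 2 by rewrite divr_gt0.
have [r0 [r00 r01 hr0]] := small_powR ds A20 (ltW C0).
pose P := r0 / 2; have P0 : 0 < P by rewrite divr_gt0.
pose x0 := Stage mu0 K 1 (A / 2) r0 0.
have g0 : good_stage A P x0.
  split=> //=.
  - by split.
  - by exists C => //; exact: ltW.
  - move=> y r Ky rr0 rr; have r1 : r <= 1 by exact: le_trans r01.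
    apply: le_trans (muC y r Ky rr0 r1) _.
    rewrite -[delta](subrK s) powR_addr// mulrA ler_wpM2r ?powR_ge0//.
    exact: hr0.
  - by rewrite /P; split=> //; lra.
have [f [f0 fS]] := dependent_choice
  (fun x => cid (next_stage_exists A x P0)) x0.
have good n : good_stage A P (f n).
  by elim: n => [|n IH]; [rewrite f0|have [] := fS n IH].
have lev n : stage_level (f n) = n.
  by elim: n => [|n IH]; [rewrite f0|have [_ _ -> _] := fS n (good n); rewrite IH].
exists (P / 2); first by rewrite divr_gt0.
apply: (@nested_mass_premeasure _ _ K s A P (fun n => stage_nbhd (f n))
  (fun n => stage_mass (f n))) => //.
- by move=> n; exact: closed_closure.
- by move=> n; have [] := fS n (good n).
- by move=> n; have [[]] := good n.
- by move=> n; have [[]] := good n.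
- move=> n B bB BKY; have [_ [xK xS] _ _ [_ _ _ _ gp]] := good n.
  apply: xS => //; apply/seteqP; split=> // y [By Sy]; rewrite -BKY.
  split=> //; split; first exact: xK.
  by apply: subset_closure; exists y => //; exact: ballxx.
- move=> n x r Kx rr0 rP; have [_ _ _ xa [_ cA Pr _ _]] := good n.
  apply: le_trans (xa x r Kx rr0 (le_trans rP (ltW Pr))) _.
  by rewrite ler_wpM2r ?powR_ge0// ltW.
- move=> x Kx xY; apply: XE => // N.
  have [_ _ _ h'] := fS N (good N).
  by have [n] := h' x (xY N.+1); rewrite lev => ? ?; exists n.
Qed.

End LimsupMeasure.
(** * Neighbourhoods of rational points *)

Section LargePower.
Context {R : realType}.

Lemma powR_invl (x p : R) : 0 <= x -> x^-1 `^ p = x `^ (- p).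
Proof. by move=> x0; rewrite -powR_inv1// -powRrM mulN1r. Qed.

Lemma large_powR (p e D : R) : 0 < p -> 0 < e -> 0 <= D ->
  exists2 Q0 : R, 1 <= Q0 & forall Q, Q0 <= Q -> D * Q `^ (- p) <= e.
Proof.
move=> p0 e0 D0; have [r [r0 r1 hr]] := small_powR p0 e0 D0.
exists r^-1 => [|Q rQ]; first by rewrite invf_ge1.
have Q0 : 0 < Q by apply: lt_le_trans rQ; rewrite invr_gt0.
rewrite -powR_invl ?(ltW Q0)//; apply: hr; first by rewrite invr_gt0.
by rewrite -[leRHS]invrK lef_pV2// posrE invr_gt0.
Qed.

Lemma exprn_powR (Q p : R) (n : nat) : (Q `^ p) ^+ n = Q `^ (p * n%:R).
Proof. by rewrite -powR_mulrn ?powR_ge0// powRrM. Qed.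

End LargePower.

Section RationalNeighbourhoods.
Context {R : realType} {d : nat}.
Implicit Types (x y theta : 'rV[R]_d) (Q eta : R).

Lemma rV_norm_le x (c : R) : 0 <= c ->
  (forall j, `|x 0 j| <= c) -> `|x| <= c.
Proof.
move=> c0 h; rewrite [leLHS]/Num.Def.normr/= mx_normrE (bigmax_le _ c0)//=.
by move=> [i j] _ /=; rewrite (ord1 i).
Qed.

Lemma rV_coord_le x j : `|x 0 j| <= `|x|.
Proof.
rewrite [leRHS]/Num.Def.normr/= mx_normrE.
by apply/bigmax_geP; right => /=; exists (0, j).
Qed.

Lemma diam_ball_ge x (r : R) : (0 < d)%N -> 0 < r -> (r%:E <= diam (ball x r))%E.
Proof.
move=> d0 r0; pose u : 'rV[R]_d := const_mx (r / 2).
have nu : `|u| = r / 2.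
  apply/eqP; rewrite eq_le; apply/andP; split.
    apply: rV_norm_le => [|j]; first by rewrite divr_ge0 ?ltW.
    by rewrite mxE ger0_norm// divr_ge0 ?ltW.
  have := rV_coord_le u (Ordinal d0); rewrite mxE ger0_norm//.
  by rewrite divr_ge0 ?ltW.
have h : r / 2 < r by rewrite ltr_pdivrMr// ltr_pMr// ltr1n.
have {1}-> : r = `|(x + u) - (x - u)|.
  rewrite opprB [u - x]addrC addrACA subrr add0r -mulr2n normrMn nu.
  by rewrite mulr2n; lra.
by apply: dist_le_diam; apply/ballP; rewrite opprD addNKr ?normrN ?opprK ?nu.
Qed.

Lemma dist_ZdP x (e : R) :
  dist_Zd x < e <-> exists p : 'rV[int]_d, `|x - map_mx intr p| < e.
Proof.
pose S := [set `|x - map_mx intr p| | p in [set: 'rV[int]_d]].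
have lS : lbound S 0 by move=> _ [p _ <-].
split=> [xe|[p pe]].
  have hS : has_inf S by split; [exists `|x - map_mx intr 0|, 0|exists 0].
  have e0 : 0 < e - dist_Zd x by rewrite subr_gt0.
  have [_ [p _ <-]] := inf_adherent e0 hS.
  by rewrite -[inf _]/(dist_Zd x) subrKC; exists p.
apply: le_lt_trans pe; apply: ge_inf; first by exists 0.
by exists p.
Qed.

Lemma A_setP Q eta theta x : A_set Q eta theta x <->
  exists (q : int) (p : 'rV[int]_d),
    [/\ Q <= q%:~R, q%:~R < 2 * Q & `|q%:~R *: x - theta - map_mx intr p| < eta].
Proof.
split=> [[q [h1 h2 /dist_ZdP[p hp]]]|[q [p [h1 h2 h3]]]]; first by exists q, p.
by exists q; split=> //; apply/dist_ZdP; exists p.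
Qed.

Lemma A_set_near Q eta eta' theta x y (e : R) : 0 < Q -> A_set Q eta theta x ->
  `|x - y| <= e -> eta + 2 * Q * e <= eta' -> A_set Q eta' theta y.
Proof.
move=> Q0 /A_setP[q [p [h1 h2 h3]]] xy he; apply/A_setP; exists q, p; split=> //.
apply: lt_le_trans he.
rewrite (_ : _ - _ = (q%:~R *: x - theta - map_mx intr p) - q%:~R *: (x - y)); last first.
  by rewrite scalerBr opprB [RHS]addrC !addrA subrK.
apply: le_lt_trans (ler_normB _ _) _; apply: ltr_leD => //.
rewrite normrZ gtr0_norm ?(lt_le_trans Q0)// ler_pM//; last exact: ltW.
by apply/ltW/(lt_le_trans Q0).
Qed.

Lemma A_set_open Q eta theta : 0 < Q -> open (A_set Q eta theta).
Proof.
move=> Q0; rewrite openE => x /A_setP[q [p [h1 h2 h3]]].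
set z := `|_| in h3; pose e := (eta - z) / (2 * Q).
have e0 : 0 < e by rewrite divr_gt0 ?subr_gt0 ?mulr_gt0.
apply/nbhs_ballP; exists e => //= y /ballP xy.
have Az : A_set Q ((eta + z) / 2) theta x.
  apply/A_setP; exists q, p; split=> //; rewrite -/z; lra.
apply/A_setP; exists q, p; split=> //.
rewrite (_ : _ - _ = (q%:~R *: x - theta - map_mx intr p) - q%:~R *: (x - y)); last first.
  by rewrite scalerBr opprB [RHS]addrC !addrA subrK.
apply: le_lt_trans (ler_normB _ _) _; rewrite -/z -ltrBrDl.
have q0 : 0 < q%:~R :> R by exact: lt_le_trans Q0 h1.
rewrite normrZ gtr0_norm//.
apply: (@le_lt_trans _ _ (2 * Q * `|x - y|)); first by rewrite ler_wpM2r// ltW.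
by rewrite mulrC -ltr_pdivlMr// mulr_gt0.
Qed.

End RationalNeighbourhoods.
Section RealMeasure.
Context {R : realType} {d : nat}.
Variables (mu : probability (borel_rV R d) R) (K : set 'rV[R]_d).
Hypotheses (cK : compact K) (muK : mu K = 1%E).

Definition mass (A : set 'rV[R]_d) : R := fine (mu A).

Lemma massE A : borel A -> mu A = (mass A)%:E.
Proof. by move=> bA; rewrite /mass fineK//; exact: fin_num_measure. Qed.

Lemma is_content_mass : is_content mass.
Proof.
split=> [A|A B bA bB AB]; first exact: fine_ge0.
by apply: EFin_inj; rewrite -massE ?EFinD -?massE ?measureU//; exact: borelU.
Qed.

Lemma massT : mass setT = 1.
Proof. by rewrite /mass probability_setT. Qed.

Lemma borel_compact : borel K.
Proof.
have cl : closed K := compact_closed (@norm_hausdorff _ _) cK.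
by rewrite -[K]setCK; apply: borelC; apply: borel_open; exact: closed_openC.
Qed.

Lemma mass_supp A : borel A -> A `&` K = set0 -> mass A = 0.
Proof.
move=> bA AK; have c := is_content_mass.
have h : mass (A `|` K) <= 1.
  by rewrite -massT; apply: (content_le c (borelU bA borel_compact) borelT).
move: h; rewrite c.2//; last exact: borel_compact.
rewrite [mass K]/mass muK /= gerDr => h.
by apply/eqP; rewrite eq_le h c.1.
Qed.

End RealMeasure.

Section Normalisation.
Context {R : realType} {d : nat}.
Variables (mu : probability (borel_rV R d) R) (K : set 'rV[R]_d).
Hypotheses (hd : (0 < d)%N) (cK : compact K) (muK : mu K = 1%E).
Variables (delta alpha beta : R) (theta : 'rV[R]_d).
Hypotheses (delta0 : 0 < delta) (hreg : ahlfors_regular mu K delta).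
Hypotheses (beta0 : 0 < beta) (ad : d%:R^-1 < alpha).
Hypothesis hlc : local_counting mu alpha beta theta.
Let m := mass mu.

Let d0 : 0 < d%:R^-1 :> R. Proof. by rewrite invr_gt0 ltr0n. Qed.

Lemma mass_counting : exists Q0 C : R, [/\ 1 < Q0, 1 <= C &
  forall Q eta, Q0 <= Q -> Q `^ (- alpha) <= eta -> eta <= Q `^ (- d%:R^-1) ->
  forall x r, measure_support mu x -> 0 < r -> Q `^ (- beta) <= r ->
  C^-1 * m (ball x r) * (Q * eta ^+ d) <= m (ball x r `&` A_set Q eta theta)
    <= C * m (ball x r) * (Q * eta ^+ d)].
Proof.
have [Q0 [C [C1 h]]] := hlc; exists (Num.max Q0 2), C; split=> //.
  by rewrite lt_max ltr1n orbT.
move=> Q eta; rewrite ge_max => /andP[Q0Q Q2] h1 h2 x r sx r0 hr.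
have Q1 : 1 < Q by apply: lt_le_trans Q2; rewrite ltr1n.
have bB := borel_ball x r.
have bA : borel (A_set Q eta theta).
  by apply: borel_open; apply: A_set_open; exact: lt_trans Q1.
have [|l1 l2] := h Q eta Q1 Q0Q h1 h2 x r sx r0.
  by apply: le_trans (diam_ball_ge x hd r0); rewrite lee_fin.
rewrite (massE mu bB) (massE mu (borelI bB bA)) in l1 l2.
by rewrite -!EFinM !lee_fin in l1 l2; apply/andP.
Qed.

Lemma diam_gt0 : exists2 r0 : R, 0 < r0 & (r0%:E < diam K)%E.
Proof.
apply: contrapT => no.
have dK0 : (diam K <= 0)%E.
  rewrite leNgt; apply/negP => dK.
  have [r r0 rK] : exists2 r : R, 0 < r & (r%:E < diam K)%E.
    move: dK; case: (diam K) => [t| |] //.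
      by rewrite lte_fin => t0; exists (t / 2); rewrite ?divr_gt0// lte_fin; lra.
    by exists 1 => //; rewrite ltry.
  by apply: no; exists r.
have [x0 Kx0] : K !=set0.
  apply/set0P/eqP => K0; move: muK; rewrite K0 measure0 => /eqP.
  by rewrite eqe eq_sym oner_eq0.
have K1 y : K y -> y = x0.
  move=> Ky; have := le_trans (dist_le_diam Ky Kx0) dK0.
  by rewrite lee_fin normr_le0 subr_eq0 => /eqP.
have c := is_content_mass mu.
have mx0 (A : set 'rV[R]_d) : borel A -> A x0 -> m A = 1.
  move=> bA Ax0; apply/eqP; rewrite eq_le -{1}(massT mu).
  rewrite (content_le c bA borelT)//= /m.
  have <- : mass mu K = 1 by rewrite /mass muK.
  by apply: (content_le c (borel_compact cK) bA) => y /K1 ->.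
have sx0 : measure_support mu x0.
  move=> r r0; rewrite massE//; last exact: borel_ball.
  by rewrite -/m mx0 ?lte_fin//; [exact: borel_ball|exact: ballxx].
have [Q0 [C [Q01 C1 h]]] := mass_counting.
have p0 : 0 < alpha * d%:R - 1.
  by rewrite subr_gt0 -ltr_pdivrMr ?ltr0n// mul1r.
have C0 : 0 <= C by exact: le_trans C1.
have [Q1 Q11 hQ1] := large_powR p0 (ltr0n R 1) (mulr_ge0 (ler0n R 2) C0).
pose Q := Num.max Q0 Q1.
have Qg1 : 1 < Q by rewrite lt_max Q01.
have Qp : 0 < Q by exact: lt_trans Qg1.
have QQ1 : Q1 <= Q by rewrite le_max lexx orbT.
pose eta := Q `^ (- alpha).
have eta0 : 0 < eta by exact: powR_gt0.
have QE : Q * eta ^+ d = Q `^ (- (alpha * d%:R - 1)).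
  rewrite exprn_powR opprB powR_addr// powRr1 ?ltW//; congr (_ * _ `^ _); ring.
have QQ0 : Q0 <= Q by rewrite le_max lexx.
have etaQ : eta <= Q `^ (- d%:R^-1).
  by apply: ler_powR; [exact: ltW|rewrite lerN2 ltW].
have Qb : Q `^ (- beta) <= 1.
  by rewrite -(powRr0 Q); apply: ler_powR; [exact: ltW|rewrite oppr_le0 ltW].
have := h Q eta QQ0 (lexx _) etaQ x0 1 sx0 ltr01 Qb.
have bB := @borel_ball _ _ x0 1.
have bA : borel (A_set Q eta theta) by apply: borel_open; exact: A_set_open.
rewrite (mx0 (ball x0 1))//; last exact: ballxx.
have [Ax0|nAx0] := pselect (A_set Q eta theta x0).
  rewrite mx0 ?mulr1; [|exact: (borelI bB bA)|by split=> //; exact: ballxx].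
  move=> /andP[_]; rewrite QE leNgt => /negP; apply.
  have := hQ1 Q QQ1; rewrite -mulrA.
  set z := C * _ => hz; lra.
rewrite /m (mass_supp cK muK (borelI bB bA)); last first.
  by apply/seteqP; split=> // y [[_ Ay] /K1 yx]; apply: nAx0; rewrite -yx.
rewrite mulr1 => /andP[+ _]; rewrite leNgt => /negP; apply.
by rewrite !mulr_gt0 ?invr_gt0 ?exprn_gt0// (lt_le_trans ltr01).
Qed.

Lemma mass_regular : exists C : R, 1 <= C /\ forall x r, K x -> 0 < r ->
  m (ball x r) <= C * r `^ delta /\
  (r <= 1 -> C^-1 * r `^ delta <= m (ball x r)).
Proof.
have [r0 r00 r0K] := diam_gt0; have [C C1 h] := hreg.
have Cp : 0 < C by exact: lt_le_trans C1.
have c := is_content_mass mu.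
have p0 : 0 < r0 `^ delta by exact: powR_gt0.
pose C' := C + C / r0 `^ delta.
have CC' : C <= C' by rewrite lerDl divr_ge0// ltW.
have C'p : 0 < C' by exact: lt_le_trans CC'.
exists C'; split; first exact: le_trans CC'.
have hs x r : K x -> 0 < r -> r <= r0 ->
    C^-1 * r `^ delta <= m (ball x r) <= C * r `^ delta.
  move=> Kx rp rr; have [|] := h x r Kx rp.
    by apply: le_lt_trans r0K; rewrite lee_fin.
  by rewrite !(massE mu (borel_ball x r)) !lee_fin => -> ->.
move=> x r Kx rp; have rd0 : 0 <= r `^ delta by exact: powR_ge0.
have [rr|rr] := leP r r0.
  have /andP[h1 h2] := hs x r Kx rp rr; split=> [|_].
    by apply: le_trans h2 _; rewrite ler_wpM2r.
  by apply: le_trans h1; rewrite ler_wpM2r// lef_pV2.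
have rr' : r0 `^ delta <= r `^ delta by apply: powR_le_base; rewrite ltW.
split=> [|r1].
  apply: (@le_trans _ _ 1).
    by rewrite -(massT mu) (content_le c (borel_ball _ _) borelT).
  apply: (@le_trans _ _ (C / r0 `^ delta * r `^ delta)); last first.
    by rewrite ler_wpM2r// lerDr ltW.
  rewrite mulrAC -mulrA -[leLHS]mul1r ler_pM//.
  by rewrite ler_pdivlMr// mul1r.
have /andP[h1 _] := hs x r0 Kx r00 (lexx _).
apply: (@le_trans _ _ (m (ball x r0))); last first.
  apply: (content_le c (borel_ball _ _) (borel_ball _ _)).
  by move=> y /ballP xy; apply/ballP; exact: lt_trans rr.
apply: le_trans h1.
apply: (@le_trans _ _ C'^-1).
  rewrite -[leRHS]mulr1 ler_wpM2l ?invr_ge0 ?(ltW C'p)//.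
  by rewrite -(powRr0 r); apply: ger_powR; rewrite ?rp// ltW.
rewrite -[leRHS]invrK lef_pV2 ?posrE ?invr_gt0 ?mulr_gt0 ?invr_gt0//.
by rewrite invfM invrK lerDr ltW.
Qed.

Lemma K_sub_support : K `<=` measure_support mu.
Proof.
have [C [C1 h]] := mass_regular => x Kx r r0.
have Cp : 0 < C by exact: lt_le_trans C1.
rewrite massE; last exact: borel_ball.
rewrite lte_fin; have r'0 : 0 < Num.min r 1 by rewrite lt_min r0 ltr01.
apply: (@lt_le_trans _ _ (mass mu (ball x (Num.min r 1)))).
  have [_ h2] := h x _ Kx r'0.
  apply: lt_le_trans (h2 _); last by rewrite ge_min lexx orbT.
  by rewrite mulr_gt0 ?invr_gt0 ?powR_gt0.
apply: (content_le (is_content_mass mu) (borel_ball _ _) (borel_ball _ _)).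
by move=> y /ballP xy; apply/ballP; apply: lt_le_trans xy _; rewrite ge_min lexx.
Qed.

End Normalisation.
Section SimplexLemma.

Lemma unitmx_or_kernel (F : fieldType) n (P : set 'rV[F]_n) :
  (exists2 A : 'M[F]_n, forall i, P (row i A) & A \in unitmx) \/
  (exists2 v : 'cV[F]_n, v != 0 & forall u, P u -> u *m v = 0).
Proof.
have [|no] := pselect (exists2 v : 'cV[F]_n, v != 0 & forall u, P u -> u *m v = 0).
  by right.
left; suff H k : (k <= n)%N -> exists2 A : 'M[F]_(k, n),
    forall i, P (row i A) & row_free A.
  by have [A PA fA] := H n (leqnn n); exists A => //; rewrite -row_free_unit.
elim: k => [_|k IH kn].
  by exists 0 => [[]//|]; rewrite /row_free mxrank0.
have [A PA fA] := IH (ltnW kn).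
have rA : \rank A = k by exact/eqP.
have : cokermx A != 0 by rewrite -mxrank_eq0 mxrank_coker rA subn_eq0 -ltnNge.
have uA0 (u : 'rV_n) : (u <= A)%MS -> u *m cokermx A = 0.
  by rewrite submxE => /eqP.
move: (cokermx A) uA0 => B uA0 /matrix0Pn[i [j cij]].
have cj0 : col j B != 0.
  by apply/negP => /eqP/matrixP/(_ i 0); rewrite !mxE => c0; rewrite c0 eqxx in cij.
have [u Pu uj] : exists2 u, P u & u *m col j B != 0.
  apply: contrapT => h; apply: no; exists (col j B) => // u Pu.
  by apply/eqP; apply: contrapT => /negP uj; apply: h; exists u.
have Pcol (l : 'I_(1 + k)) : P (row l (col_mx u A)).
  case: (split_ordP l) => l' ->; last by rewrite rowKd.
  by rewrite rowKu (ord1 l') row_id.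
exists (col_mx u A); first exact: Pcol.
have AuA : (A < col_mx u A)%MS.
  rewrite ltmxE -{1}[A]mul1mx; apply/andP; split.
    by rewrite mul1mx -addsmxE addsmxSr.
  rewrite -addsmxE addsmx_sub submx_refl andbT; apply/negP => uA.
  by move: uj; rewrite colE mulmxA uA0// mul0mx eqxx.
by have := rank_ltmx AuA; rewrite rA /row_free eqn_leq rank_leq_row.
Qed.

Lemma det_le (R : realFieldType) n (A : 'M[R]_n) (b : 'I_n -> R) :
  (forall i j, `|A i j| <= b j) -> `|\det A| <= (n`!)%:R * \prod_j b j.
Proof.
move=> h; apply: le_trans (ler_norm_sum _ _ _) _.
rewrite -(card_Sn n) mulr_natl -sumr_const; apply: ler_sum => s _.
rewrite normrM normrX normrN1 expr1n mul1r normr_prod.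
rewrite [leRHS](reindex_inj (@perm_inj _ s)) /=.
by apply: ler_prod => i _; rewrite normr_ge0 h.
Qed.

Lemma simplex_lemma (R : realType) d (x : 'rV[R]_d) (Q b : R) : 0 < Q -> 0 <= b ->
  (0 < d)%N -> ((1 + d)`!)%:R * (2 * Q * b ^+ d) < 1 ->
  exists (a0 : R) (a : 'rV[R]_d), a != 0 /\
  forall (q : int) (p : 'rV[int]_d), Q <= q%:~R -> q%:~R < 2 * Q ->
    `|map_mx intr p - q%:~R *: x| <= b ->
    a0 * q%:~R + \sum_j (map_mx intr p - q%:~R *: x) 0 j * a 0 j = 0.
Proof.
move=> Q0 b0 d0 small.
pose vec (q : int) (p : 'rV[int]_d) : 'rV[R]_(1 + d) :=
  row_mx (q%:~R)%:M (map_mx intr p - q%:~R *: x).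
pose P : set 'rV[R]_(1 + d) := [set u | exists q p, [/\ Q <= q%:~R, q%:~R < 2 * Q,
    `|map_mx intr p - q%:~R *: x| <= b & u = vec q p]].
have [[A PA Au]|[v v0 hv]] := unitmx_or_kernel P.
  exfalso; have /choice[qp qpP] : forall i, exists qp : int * 'rV[int]_d,
      [/\ Q <= qp.1%:~R, qp.1%:~R < 2 * Q,
        `|map_mx intr qp.2 - qp.1%:~R *: x| <= b & row i A = vec qp.1 qp.2].
    by move=> i; have [q [p h]] := PA i; exists (q, p).
  pose N : 'M[int]_(1 + d) := \matrix_i row_mx (qp i).1%:M (qp i).2.
  pose U : 'M[R]_(1 + d) := block_mx 1%:M (- x) 0 1%:M.
  have AE : A = map_mx intr N *m U.
    apply/row_matrixP => i; have [_ _ _ ->] := qpP i.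
    rewrite row_mul -map_row rowK map_row_mx mul_row_block.
    rewrite mulmx1 mulmx0 addr0 mulmx1 map_scalar_mx /= mul_scalar_mx scalerN.
    by rewrite addrC.
  have dU : \det U = 1 by rewrite det_ublock !det1 mulr1.
  have dA : \det A = (\det N)%:~R by rewrite AE det_mulmx dU mulr1 det_map_mx.
  have : 1 <= `|\det A|.
    rewrite dA -intr_norm (_ : 1 = 1%:~R)// ler_int -gtz0_ge1 normr_gt0.
    by rewrite -(intr_eq0 R) -dA -unitfE -unitmxE.
  rewrite leNgt => /negP; apply; apply: le_lt_trans small.
  pose bb (j : 'I_(1 + d)) := if (j : nat) == 0%N then 2 * Q else b.
  apply: le_trans (det_le (b := bb) _) _.
    move=> i j; have [h1 h2 h3 h4] := qpP i.
    have -> : A i j = vec (qp i).1 (qp i).2 0 j by rewrite -h4 mxE.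
    case: (split_ordP j) => k ->; last first.
      by rewrite /vec row_mxEr /bb /=; apply: le_trans (rV_coord_le _ _) h3.
    rewrite /vec row_mxEl (ord1 k) mxE eqxx mulr1n /bb /= ger0_norm ?(ltW h2)//.
    exact: le_trans (ltW Q0) h1.
  rewrite ler_wpM2l// (_ : \prod_j bb j = \prod_(j < d.+1) bb j)//.
  by rewrite big_ord_recl /= prodr_const card_ord.
pose a : 'rV[R]_d := (dsubmx v)^T; pose a0 := usubmx v 0 0.
have hqp q p : Q <= q%:~R -> q%:~R < 2 * Q -> `|map_mx intr p - q%:~R *: x| <= b ->
    a0 * q%:~R + \sum_j (map_mx intr p - q%:~R *: x) 0 j * a 0 j = 0.
  move=> h1 h2 h3; have : vec q p *m v = 0 by apply: hv; exists q, p.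
  move=> h; rewrite -[RHS](_ : (vec q p *m v) 0 0 = 0); last by rewrite h mxE.
  rewrite -[v]vsubmxK /vec mul_row_col mul_scalar_mx [RHS]mxE.
  congr (_ + _); first by rewrite [RHS]mxE mulrC.
  by rewrite [RHS]mxE; apply: eq_bigr => j _; rewrite [a 0 j]mxE.
have [a00|aN0] := eqVneq a 0; last by exists a0, a.
exists 0, (const_mx 1); split.
  apply/negP => /eqP/matrixP/(_ 0 (Ordinal d0)); rewrite !mxE => /eqP.
  by rewrite oner_eq0.
move=> q p h1 h2 h3; exfalso; have := hqp q p h1 h2 h3.
rewrite a00 big1 ?addr0; last by move=> j _; rewrite [X in _ * X]mxE mulr0.
move/eqP; rewrite mulf_eq0 (gt_eqF (lt_le_trans Q0 h1)) orbF => /eqP a0E.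
move/negP: v0; apply; rewrite -[v]vsubmxK col_mx_eq0; apply/andP; split.
  by apply/eqP/matrixP => i j; rewrite !ord1 [RHS]mxE; exact: a0E.
by rewrite -trmx_eq0 -/a a00.
Qed.

End SimplexLemma.
Lemma unbounded_infinite (A : set nat) :
  (forall n, exists2 q, (n <= q)%N & A q) -> infinite_set A.
Proof.
move=> h /finite_seqP[l lA]; have [q nq Aq] := h (\max_(i <- l) i).+1.
have ql : q \in l by move: Aq; rewrite lA.
by have := leq_bigmax_seq (F := id) q ql isT; rewrite leqNgt nq.
Qed.

Lemma infinite_unbounded (A : set nat) : infinite_set A ->
  forall n, exists2 q, (n <= q)%N & A q.
Proof.
move=> iA n; apply: contrapT => no; apply: iA.
apply: (sub_finite_set _ (finite_II n)) => q Aq /=.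
by rewrite ltnNge; apply/negP => nq; apply: no; exists q.
Qed.

Section LowerOrder.
Context {R : realType}.
Variable psi : nat -> R.

Let u (q : nat) : \bar R := (- lne (psi q)%:E / (ln q%:R)%:E)%E.

Lemma ln_nat_gt0 (q : nat) : (1 < q)%N -> 0 < ln q%:R :> R.
Proof. by move=> q1; rewrite ln_gt0// ltr1n. Qed.

Lemma order_ratioE (q : nat) : (1 < q)%N ->
  u q = if psi q <= 0 then +oo%E else (- ln (psi q) / ln q%:R)%:E.
Proof.
move=> q1; have l0 := ln_nat_gt0 q1; rewrite /u /lne; case: ifP => _.
  by rewrite inver gt_eqF//= gt0_mulye// lte_fin invr_gt0.
by rewrite inver gt_eqF// EFinM EFinN.
Qed.

Lemma lower_orderE : lower_order psi = ereal_sup (range (einfs u)).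
Proof.
rewrite /lower_order limn_einf_lim; apply/cvg_lim => //.
exact: ereal_nondecreasing_cvgn (nondecreasing_einfs u).
Qed.

Lemma lt_lower_order (t : R) : (t%:E < lower_order psi)%E ->
  exists n, forall q, (n <= q)%N -> psi q < q%:R `^ (- t).
Proof.
rewrite lower_orderE => /ereal_sup_gt[_ [n _ <-] tn].
exists (maxn n 2) => q; rewrite geq_max => /andP[nq q1].
have q0 : 0 < q%:R :> R by rewrite ltr0n ltnW.
have l0 := ln_nat_gt0 q1.
have : (t%:E < u q)%E.
  by apply: lt_le_trans tn _; apply: ereal_inf_lbound; exists q.
rewrite order_ratioE//; case: (leP (psi q) 0) => [p0 _|p0];
  first exact: le_lt_trans p0 (powR_gt0 _ q0).
rewrite lte_fin ltr_pdivlMr// => h.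
by rewrite -ltr_ln ?posrE ?powR_gt0// ln_powR mulNr ltrNr.
Qed.

Lemma lower_order_lt (t : R) : (lower_order psi < t%:E)%E ->
  forall n, exists2 q, (n <= q)%N & (0 < q)%N /\ q%:R `^ (- t) <= psi q.
Proof.
rewrite lower_orderE => ht n.
have : (einfs u (maxn n 2) < t%:E)%E.
  by apply: le_lt_trans ht; apply: ereal_sup_ubound; exists (maxn n 2).
move=> /ereal_inf_lt[_ [q /= + <-]]; rewrite geq_max => /andP[nq q1].
have q0 : 0 < q%:R :> R by rewrite ltr0n ltnW.
have l0 := ln_nat_gt0 q1.
rewrite order_ratioE//; case: (leP (psi q) 0) => [_|p0]; first by rewrite ltNge leey.
rewrite lte_fin ltr_pdivrMr// => h; exists q => //; split; first exact: ltnW.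
by rewrite -ler_ln ?posrE ?powR_gt0// ln_powR mulNr lerNl ltW.
Qed.

Lemma dyadic_lower_bound (c tau : R) : monotonic psi -> 0 < c -> 0 < tau ->
  infinite_set [set q : nat | (0 < q)%N /\ c * q%:R `^ (- tau) <= psi q] ->
  exists c1 : R, [/\ 0 < c1, c1 <= 1 & forall N : R, exists2 Q, N <= Q &
    0 < Q /\ forall q : nat, Q <= q%:R -> q%:R < 2 * Q -> 2 * (c1 * Q `^ (- tau)) <= psi q].
Proof.
move=> mono c0 tau0 /infinite_unbounded inf.
case: mono => mono.
  have [q0 _ [q00 hq0]] := inf 0%N.
  have p0 : 0 < psi q0 by apply: lt_le_trans hq0; rewrite mulr_gt0// powR_gt0// ltr0n.
  have [Q1 Q11 hQ1] := large_powR tau0 p0 (ler0n R 2).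
  exists 1; split=> // N; exists (Num.max N (Num.max Q1 q0%:R)).
    by rewrite le_max lexx.
  set Q := Num.max _ _.
  have Q1Q : Q1 <= Q by rewrite !le_max lexx orbT.
  have q0Q : q0%:R <= Q by rewrite !le_max lexx !orbT.
  split; first by apply: lt_le_trans q0Q; rewrite ltr0n.
  move=> q Qq _; rewrite mul1r; apply: le_trans (hQ1 _ Q1Q) _; apply: mono => //.
  by rewrite -(ler_nat R) (le_trans q0Q).
have p2 : 0 < 2 `^ (- tau) :> R by rewrite powR_gt0.
exists (Num.min 1 (c * 2 `^ (- tau) / 2)); split.
- by rewrite lt_min ltr01 divr_gt0// mulr_gt0.
- by rewrite ge_min lexx.
move=> N; have [q0 nq0 [q00 hq0]] := inf (Num.truncn (2 * N)).+1.
have q0R : 0 < q0%:R :> R by rewrite ltr0n.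
exists (q0%:R / 2).
  rewrite ler_pdivlMr// mulrC; apply/ltW/(lt_le_trans (truncnS_gt _)).
  by rewrite ler_nat.
split; first by rewrite divr_gt0.
move=> q h1 h2; have q_gt0 : (0 < q)%N.
  by rewrite -(ltr0n R); apply: lt_le_trans h1; rewrite divr_gt0.
have qq0 : (q <= q0)%N.
  by rewrite ltnW// -(ltr_nat R); move: h2; rewrite mulrC divfK ?pnatr_eq0.
apply: le_trans (mono q q0 q_gt0 qq0); apply: le_trans hq0.
have -> : q0%:R `^ (- tau) = 2 `^ (- tau) * (q0%:R / 2) `^ (- tau).
  by rewrite -powRM ?divr_ge0// mulrC divfK ?pnatr_eq0.
rewrite !mulrA ler_wpM2r ?powR_ge0//.
apply: (@le_trans _ _ (2 * (c * 2 `^ (- tau) / 2))); last by rewrite mulrC divfK ?pnatr_eq0.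
by rewrite ler_pM2l// ge_min lexx orbT.
Qed.

End LowerOrder.
(** * Consequences of local counting *)

Section DiamBall.
Context {R : realType} {V : normedModType R}.

Lemma diam_ball_le (x : V) (r : R) : 0 <= r -> (diam (ball x r) <= (2 * r)%:E)%E.
Proof.
move=> r0; apply: diam_le => [|y z /ballP xy /ballP xz]; first by rewrite mulr_ge0.
rewrite -(subrKA x); apply: le_trans (ler_normD _ _) _.
by rewrite distrC; lra.
Qed.

Lemma diam_set0 : diam (@set0 V) = 0%E.
Proof.
by apply/eqP; rewrite eq_le diam_ge0 andbT; apply: diam_le.
Qed.

Lemma hgauge_set0 (s : R) : hgauge s (@set0 V) = 0%E.
Proof. by rewrite /hgauge eqxx. Qed.

Lemma hgauge_le_powR (s r : R) (U : set V) : 0 < s -> (diam U <= r%:E)%E ->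
  (hgauge s U <= (r `^ s)%:E)%E.
Proof.
move=> s0 dU; rewrite /hgauge; case: ifP => _; first by rewrite lee_fin powR_ge0.
rewrite [s < 0]ltNge (ltW s0) /=; move: dU (diam_ge0 U).
by case: (diam U) => // t; rewrite !lee_fin => tr t0; rewrite powR_le_base// ltW.
Qed.

Lemma nneseries_le_bound (f : nat -> \bar R) (b : \bar R) : (forall n, 0 <= f n)%E ->
  (forall N, \sum_(0 <= i < N) f i <= b)%E -> (\sum_(0 <= i <oo) f i <= b)%E.
Proof.
move=> f0 fb; apply: lime_le; first by apply: is_cvg_nneseries => *; exact: f0.
by near=> N; exact: fb.
Unshelve. all: by end_near. Qed.

End DiamBall.

Section Counting.
Context {R : realType} {d : nat}.
Variables (K : set 'rV[R]_d) (m : set 'rV[R]_d -> R) (theta : 'rV[R]_d).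
Variables (delta alpha beta CR CL Q0 : R).
Hypotheses (d0 : (0 < d)%N) (cK : compact K) (cm : is_content m).
Hypotheses (m1 : m setT = 1) (beta0 : 0 < beta).
Hypotheses (CR1 : 1 <= CR) (CL1 : 1 <= CL) (Q01 : 1 < Q0).
Hypothesis m_supp : forall A, borel A -> A `&` K = set0 -> m A = 0.
Hypothesis m_le : forall x (r : R), K x -> 0 < r -> m (ball x r) <= CR * r `^ delta.
Hypothesis m_ge : forall x (r : R), K x -> 0 < r -> r <= 1 ->
  CR^-1 * r `^ delta <= m (ball x r).
Hypothesis m_count : forall Q eta : R, Q0 <= Q -> Q `^ (- alpha) <= eta ->
  eta <= Q `^ (- d%:R^-1) -> forall x (r : R), K x -> 0 < r -> Q `^ (- beta) <= r ->
  CL^-1 * m (ball x r) * (Q * eta ^+ d) <= m (ball x r `&` A_set Q eta theta)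
    <= CL * m (ball x r) * (Q * eta ^+ d).

Let Q0p (Q : R) : Q0 <= Q -> 0 < Q.
Proof. by move=> h; apply: lt_le_trans h; apply: lt_trans Q01. Qed.

Lemma borel_A_set (Q eta : R) : 0 < Q -> borel (A_set Q eta theta).
Proof. by move=> ?; apply: borel_open; exact: A_set_open. Qed.

Lemma content_le_cover_supp n (F : nat -> set 'rV[R]_d) A :
  (forall i, (i < n)%N -> borel (F i)) -> borel A ->
  (forall y, A y -> K y -> exists2 i, (i < n)%N & F i y) ->
  m A <= \sum_(i < n) m (F i).
Proof.
move=> bF bA AF; have bU := borel_bigsetU bF.
apply: le_trans (content_le_bigsetU cm bF).
rewrite -(setUIDK A (\big[setU/set0]_(i < n) F i)) cm.2.
- rewrite [X in _ + X]m_supp ?addr0.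
  + by apply: (content_le cm (borelI bA bU) bU) => y [].
  + exact: (borelD bA bU).
  + apply/seteqP; split=> // y [[Ay nU] Ky]; apply: nU.
    by have [i ni Fy] := AF y Ay Ky; rewrite -bigcup_mkord; exists i.
- exact: (borelI bA bU).
- exact: (borelD bA bU).
- by apply/seteqP; split=> // y [[_ h] [_ nh]].
Qed.

Lemma A_set_mass : exists2 C : R, 0 < C &
  forall Q eta : R, Q0 <= Q -> Q `^ (- alpha) <= eta -> eta <= Q `^ (- d%:R^-1) ->
  m (A_set Q eta theta) <= C * (Q * eta ^+ d).
Proof.
have [n [x [Kx _ netx]]] := compact_net cK (@subset_refl _ K) ltr01.
exists (n%:R * CL + 1); first by rewrite ltr_wpDl// mulr_ge0// (le_trans _ CL1).
move=> Q eta Q0Q h1 h2; have Qp := Q0p Q0Q; have bA := borel_A_set eta Qp.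
have e0 : 0 < eta by apply: lt_le_trans h1; exact: powR_gt0.
have q0 : 0 <= Q * eta ^+ d by rewrite mulr_ge0 ?exprn_ge0// ltW.
apply: le_trans (@content_le_cover_supp n (fun i => ball (x i) 1 `&` A_set Q eta theta) _ _ bA _) _.
- by move=> i _; exact: (borelI (borel_ball _ _) bA).
- by move=> y Ay /netx[i ni By]; exists i.
apply: (@le_trans _ _ (\sum_(i < n) CL * (Q * eta ^+ d))).
  apply: ler_sum => i _; have Qb : Q `^ (- beta) <= 1.
    rewrite -(powRr0 Q); apply: ler_powR; last by rewrite oppr_le0 ltW.
    by apply: le_trans Q0Q; exact: ltW.
  have /andP[_ h] := m_count Q0Q h1 h2 (Kx _ (ltn_ord i)) ltr01 Qb.
  apply: le_trans h _; rewrite ler_wpM2r// -[leRHS]mulr1 ler_wpM2l ?(le_trans _ CL1)//.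
  by rewrite -m1 (content_le cm (borel_ball _ _) borelT).
by rewrite sumr_const card_ord -[leLHS]mulr_natl mulrA [leRHS]mulrDl mul1r lerDl.
Qed.

Lemma A_set_cover : exists2 C : R, 0 < C &
  forall Q eta : R, Q0 <= Q -> eta <= 1 ->
  Q `^ (- alpha) <= 2 * eta -> 2 * eta <= Q `^ (- d%:R^-1) ->
  exists (n : nat) (x : nat -> 'rV[R]_d),
    (forall y, K y -> A_set Q eta theta y -> exists2 i, (i < n)%N & ball (x i) (eta / Q) y) /\
    n%:R <= C * ((Q / eta) `^ delta * (Q * eta ^+ d)).
Proof.
have [C C0 hC] := A_set_mass.
have CRp : 0 < CR by exact: lt_le_trans CR1.
exists (C * CR * 2 `^ delta * 2 ^+ d); first by rewrite !mulr_gt0 ?powR_gt0 ?exprn_gt0.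
move=> Q eta Q0Q e1 h1 h2; have Qp := Q0p Q0Q; have bA := borel_A_set (2 * eta) Qp.
have e0 : 0 < eta.
  by rewrite -(pmulr_rgt0 _ (ltr0n R 2)); apply: lt_le_trans h1; exact: powR_gt0.
have c0 : 0 < eta / Q by rewrite divr_gt0.
have Q1 : 1 <= Q by apply: le_trans Q0Q; exact: ltW.
have [n [x [Xx sx netx]]] := compact_net cK (@subIsetl _ K (A_set Q eta theta)) c0.
exists n, x; split=> [y Ky Ay|]; first by apply: netx.
pose c := eta / Q / 2; have cp : 0 < c by rewrite divr_gt0.
have c1 : c <= 1.
  rewrite /c ler_pdivrMr// mul1r ler_pdivrMr//.
  by apply: (le_trans e1); nra.
have sumle : \sum_(i < n) m (ball (x i) c) <= m (A_set Q (2 * eta) theta).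
  rewrite -(content_bigsetU cm (F := fun i => ball (x i) c)).
  - apply: (content_le cm _ bA).
      by apply: (borel_bigsetU (F := fun i => ball (x i) c)) => i _; exact: borel_ball.
    rewrite -(bigcup_mkord n (fun i => ball (x i) c)) => y [i /= ni /ballP xy].
    have [_ Ax] := Xx i ni; apply: (A_set_near Qp Ax (ltW xy)).
    by rewrite le_eqVlt; apply/orP; left; apply/eqP; rewrite /c; field; exact: lt0r_neq0.
  - by move=> i _; exact: borel_ball.
  - move=> i j ijn; apply/seteqP; split=> // y [/ballP yi /ballP yj].
    have := sx i j ijn; rewrite leNgt => /negP; apply.
    rewrite (splitr (eta / Q)) -(subrKA y); apply: le_lt_trans (ler_normD _ _) _.
    by rewrite ltrD// distrC.
have nle : n%:R * (CR^-1 * c `^ delta) <= C * (Q * (2 * eta) ^+ d).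
  apply: le_trans (hC Q (2 * eta) Q0Q h1 h2); apply: le_trans sumle.
  rewrite mulr_natl -[n in _ *+ n]card_ord -sumr_const; apply: ler_sum => i _.
  by apply: m_ge => //; have [] := Xx i (ltn_ord i).
rewrite -ler_pdivlMr ?mulr_gt0 ?invr_gt0 ?powR_gt0// in nle.
apply: le_trans nle _; rewrite le_eqVlt; apply/orP; left; apply/eqP.
have cE : (Q / eta) `^ delta * 2 `^ delta = (c `^ delta)^-1.
  rewrite -powRM ?divr_ge0 ?(ltW Qp) ?(ltW e0)// -powRN -powR_invl ?(ltW cp)//.
  by congr powR; rewrite /c; field; rewrite !lt0r_neq0.
rewrite exprMn invfM invrK -cE; ring.
Qed.

Lemma limsup_measure0 (t s : R) (X : set 'rV[R]_d) : d%:R^-1 < t -> t < alpha -> 0 < s ->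
  delta + (1 - t * d%:R) / (1 + t) < s ->
  X `<=` K -> (forall x, X x -> forall N, exists2 k, (N <= k)%N &
    A_set (2 ^+ k) ((2 ^+ k) `^ (- t)) theta x) ->
  hausdorff_measure s X = 0%E.
Proof.
move=> dt ta s0 hs XK XA; apply: hausdorff_measure_eq0 => rho e rho0 e0.
have dp : 0 < d%:R^-1 :> R by rewrite invr_gt0 ltr0n.
have t0 : 0 < t by exact: lt_trans dt.
have [C C0 hC] := A_set_cover.
pose g := (1 + t) * (s - delta) - (1 - t * d%:R).
have g0 : 0 < g.
  have h : (1 - t * d%:R) / (1 + t) < s - delta by rewrite ltrBrDl.
  rewrite ltr_pdivrMr in h; last by rewrite addr_gt0.
  by rewrite subr_gt0 [ltRHS]mulrC.
pose q k : R := 2 ^+ k; pose eta k := q k `^ (- t).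
have q0 k : 0 < q k by rewrite exprn_gt0.
have q1 k : 1 <= q k by rewrite exprn_ege1// ler1n.
have qk k : q k = 2 `^ k%:R by rewrite powR_mulrn.
pose z : R := 2 `^ (- g).
have z0 : 0 < z by exact: powR_gt0.
have z1 : z < 1.
  by rewrite /z /powR pnatr_eq0 /= expR_lt1 mulNr oppr_lt0 mulr_gt0 ?ln_gt0 ?ltr1n.
have qz k : q k `^ (- g) = z ^+ k.
  by rewrite /z exprn_powR qk -powRrM mulrC.
pose B := C * 2 `^ s / (1 - z).
have B0 : 0 < B by rewrite divr_gt0 ?mulr_gt0 ?powR_gt0// subr_gt0.
have dt0 : 0 < t - d%:R^-1 by rewrite subr_gt0.
have at0 : 0 < t + 1 by rewrite ltr_wpDr.
have [Q1 Q11 h1] := large_powR dt0 ltr01 (ler0n R 2).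
have [Q2 Q21 h2] := large_powR at0 rho0 (ler0n R 2).
have [Q3 Q31 h3] := large_powR g0 e0 (ltW B0).
have [k0 hk0] : exists k0, forall k, (k0 <= k)%N ->
    [/\ Q0 <= q k, Q1 <= q k, Q2 <= q k & Q3 <= q k].
  pose M := Num.max (Num.max Q0 Q1) (Num.max Q2 Q3).
  exists (Num.truncn M).+1 => k kM.
  have : M <= q k.
    apply/ltW/(lt_le_trans (truncnS_gt M)).
    apply: (@le_trans _ _ k%:R); first by rewrite ler_nat.
    by rewrite /q -natrX ler_nat ltnW// ltn_expl.
  by rewrite /M !ge_max => /andP[/andP[? ?] /andP[? ?]].
have cE k : eta k / q k = q k `^ (- (t + 1)).
  rewrite /eta opprD powR_addr//; congr (_ * _); rewrite powRN powRr1 ?ltW//.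
have /choice[nx nxP] : forall k, exists nx : nat * (nat -> 'rV[R]_d), (k0 <= k)%N ->
    (forall y, K y -> A_set (q k) (eta k) theta y ->
       exists2 i, (i < nx.1)%N & ball (nx.2 i) (eta k / q k) y) /\
    nx.1%:R <= C * ((q k / eta k) `^ delta * (q k * eta k ^+ d)).
  move=> k; have [kk|kk] := leqP k0 k; last by exists (0%N, fun=> 0).
  have [a1 a2 _ _] := hk0 k kk.
  have [|||n [x hx]] := hC (q k) (eta k) a1; last by exists (n, x).
  - rewrite -(powRr0 (q k)); apply: ler_powR => //; lra.
  - apply: (@le_trans _ _ (eta k)); last by rewrite ler_peMl ?powR_ge0// ler1n.
    by apply: ler_powR => //; rewrite lerN2 ltW.
  - rewrite -[leRHS]mul1r -ler_pdivrMr ?powR_gt0// -powRN opprK -mulrA -powR_addr//.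
    by have := h1 _ a2; rewrite opprB [- t + _]addrC.
pose U k j := if (k0 <= k)%N && (j < (nx k).1)%N then ball ((nx k).2 j) (eta k / q k)
  else set0.
exists U; split.
- move=> x Xx; have [k kk Ax] := XA x Xx k0.
  have [h _] := nxP k kk; have [j jn Bj] := h x (XK x Xx) Ax.
  by exists k, j; rewrite /U kk jn.
- move=> k j; rewrite /U; case: ifP => [/andP[kk _]|_]; last first.
    by rewrite diam_set0 lee_fin ltW.
  have [_ _ a3 _] := hk0 k kk.
  apply: le_trans (diam_ball_le _ _) _; first by rewrite divr_ge0 ?powR_ge0 ?ltW.
  by rewrite lee_fin cE h2.
have hU k : (\sum_(0 <= j <oo) hgauge s (U k j) <=
    (if (k0 <= k)%N then B * (z ^+ k - z ^+ k.+1) else 0)%:E)%E.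
  have [kk|kk] := leqP k0 k; last first.
    rewrite eseries0// => j _ _; rewrite /U leqNgt kk; exact: hgauge_set0.
  rewrite (nneseries_split 0 (nx k).1); last by move=> j _; exact: hgauge_ge0.
  rewrite add0n [X in (_ + X)%E]eseries0 ?adde0; last first.
    by move=> j nj _; rewrite /U kk ltnNge nj; exact: hgauge_set0.
  apply: (@le_trans _ _ (\sum_(0 <= j < (nx k).1) ((2 * (eta k / q k)) `^ s)%:E)%E).
    apply: lee_sum => j _; apply: hgauge_le_powR => //; rewrite /U; case: ifP => _.
      by apply: diam_ball_le; rewrite divr_ge0 ?powR_ge0 ?ltW.
    by rewrite diam_set0 lee_fin mulr_ge0 ?divr_ge0 ?powR_ge0 ?ltW.
  rewrite sumEFin lee_fin sumr_const_nat subn0 -[leLHS]mulr_natl.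
  have [_ hn] := nxP k kk.
  apply: le_trans (ler_wpM2r (powR_ge0 _ _) hn) _.
  rewrite le_eqVlt; apply/orP; left; apply/eqP.
  have z1n : 1 - z != 0 by rewrite subr_eq0 gt_eqF.
  rewrite (_ : B * _ = C * 2 `^ s * q k `^ (- g)); last first.
    by rewrite qz exprS /B; field.
  rewrite cE [(2 * _) `^ s]powRM ?powR_ge0//.
  rewrite -powRrM /eta exprn_powR (_ : q k / q k `^ (- t) = q k `^ (1 + t)); last first.
    by rewrite -powRN opprK powR_addr// powRr1// ltW.
  rewrite -powRrM (_ : q k * _ = q k `^ (1 - t * d%:R)); last first.
    by rewrite powR_addr// powRr1 ?ltW// mulNr.
  rewrite (_ : - g = (1 + t) * delta + (1 - t * d%:R) + - (t + 1) * s); last first.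
    by rewrite /g; ring.
  by rewrite !powR_addr//; ring.
apply: nneseries_le_bound => [k|N]; first by apply: nneseries_ge0 => *; exact: hgauge_ge0.
apply: le_trans (lee_sum _ (fun k _ => hU k)) _.
rewrite sumEFin lee_fin.
have [_ _ _ a4] := hk0 k0 (leqnn _).
suff : \sum_(0 <= k < N) (if (k0 <= k)%N then B * (z ^+ k - z ^+ k.+1) else 0) <=
    B * (z ^+ k0 - z ^+ (maxn N k0)).
  move=> /le_trans; apply; apply: le_trans (h3 _ a4); rewrite qz ler_pM2l//.
  by rewrite gerBl exprn_ge0 ?ltW.
elim: N => [|N IH]; first by rewrite big_geq// max0n subrr mulr0.
rewrite big_nat_recr//=; apply: le_trans (lerD IH (lexx _)) _.
have [kN|kN] := leqP k0 N.
  rewrite (maxn_idPl (leqW kN)) -mulrDr ler_pM2l//.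
  by rewrite addrA subrK.
by rewrite addr0 (maxn_idPr kN).
Qed.

Lemma limsup_measure_pinfty (tau c s C Q1 : R) (P : set R) (X : set 'rV[R]_d) :
  d%:R^-1 < tau -> tau < alpha -> 0 < c -> c <= 1 -> 0 < s -> s < delta -> 0 < C ->
  (forall Q x (r : R), Q1 <= Q -> K x -> 0 < r -> r <= 1 -> r < Q `^ (- beta) ->
     m (ball x r `&` A_set Q (c * Q `^ (- tau)) theta)
       <= C * r `^ s * (Q * (c * Q `^ (- tau)) ^+ d)) ->
  (forall N : R, exists2 Q, N <= Q & P Q) ->
  (forall x, K x -> (forall N : R, exists Q, [/\ N <= Q, P Q &
      A_set Q (2 * (c * Q `^ (- tau))) theta x]) -> X x) ->
  hausdorff_measure s X = +oo%E.
Proof.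
move=> dtau taua c0 c1 s0 sd C0 hB hP hX.
have CRp : 0 < CR by exact: lt_le_trans CR1.
have CLp : 0 < CL by exact: lt_le_trans CL1.
have p1 : 0 < alpha - tau by rewrite subr_gt0.
have [Q2 Q21 hQ2] := large_powR p1 c0 ler01.
pose M := Num.max (Num.max Q0 Q1) Q2.
have /choice[q qP] : forall n : nat, exists Q, Num.max M n%:R <= Q /\ P Q.
  by move=> n; have [Q hQ PQ] := hP (Num.max M n%:R); exists Q.
have qM n : [/\ Q0 <= q n, Q1 <= q n, Q2 <= q n & n%:R <= q n].
  have [+ _] := qP n; rewrite !ge_max.
  by move=> /andP[/andP[/andP[? ?] ?] ?].
have q0 n : 0 < q n by have [/Q0p] := qM n.
have q1 n : 1 <= q n by have [h _ _ _] := qM n; apply: le_trans h; exact: ltW.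
pose eta n := c * q n `^ (- tau).
have eta0 n : 0 < eta n by rewrite mulr_gt0 ?powR_gt0.
pose E n := A_set (q n) (eta n) theta.
have bE n : borel (E n) by exact: borel_A_set.
pose k n := q n * eta n ^+ d.
have k0 n : 0 < k n by rewrite mulr_gt0 ?exprn_gt0.
pose h n (A : set 'rV[R]_d) := (k n)^-1 * m (A `&` E n).
pose CC := CL * CR + C.
have CLR0 : 0 < CL * CR by rewrite mulr_gt0.
have CLRC : CL * CR <= CC by rewrite lerDl ltW.
have CC0 : 0 < CC by exact: lt_le_trans CLRC.
have hcount n x (r : R) : K x -> q n `^ (- beta) <= r ->
    CL^-1 * m (ball x r) <= h n (ball x r) <= CL * m (ball x r).
  move=> Kx rq; have r0 : 0 < r by apply: lt_le_trans rq; exact: powR_gt0.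
  have [a0 _ a2 _] := qM n.
  have /andP[h1 h2] : CL^-1 * m (ball x r) * k n <= m (ball x r `&` E n)
      <= CL * m (ball x r) * k n.
    apply: m_count => //.
      have h3 := hQ2 _ a2; rewrite mul1r opprB powR_addr// in h3.
      by rewrite /eta -ler_pdivrMr ?powR_gt0// -powRN opprK mulrC.
    rewrite /eta -[leRHS]mul1r ler_pM ?powR_ge0 ?(ltW c0)//.
    by apply: ler_powR => //; rewrite lerN2 ltW.
  by rewrite /h ler_pdivlMl// ler_pdivrMl// ![k n * _]mulrC h1 h2.
have hlarge n x (r : R) : K x -> q n `^ (- beta) <= r -> r <= 1 ->
    (CL * CR)^-1 * r `^ delta <= h n (ball x r) <= CL * CR * r `^ delta.
  move=> Kx rq r1; have r0 : 0 < r by apply: lt_le_trans rq; exact: powR_gt0.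
  have /andP[h1 h2] := hcount n x r Kx rq; apply/andP; split.
    apply: le_trans h1; rewrite invfM -mulrA ler_wpM2l ?invr_ge0 ?(ltW CLp)//.
    exact: m_ge.
  by apply: le_trans h2 _; rewrite -mulrA ler_wpM2l ?(ltW CLp)// m_le.
have ch n : is_content (h n).
  by apply: is_content_scale; [exact: is_content_restr|rewrite invr_ge0 ltW].
apply: (@hausdorff_measure_limsup _ _ K s delta CC cK s0 sd CC0 h
  (fun n => K `&` E n) (fun n => A_set (q n) (2 * eta n) theta) ch _ _ _ _ _ _ m).
- by move=> n y [].
- move=> n A bA AKE; rewrite /h m_supp ?mulr0//; first exact: (borelI bA (bE n)).
  by rewrite -setIA [E n `&` K]setIC.
- move=> w w0; have [Q3 Q31 hQ3] := large_powR beta0 w0 ler01.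
  exists (Num.truncn Q3).+1 => n nQ x r Kx wr r1.
  have Q3n : Q3 <= q n.
    have [_ _ _] := qM n; apply: le_trans.
    by apply/ltW/(lt_le_trans (truncnS_gt Q3)); rewrite ler_nat.
  have qr : q n `^ (- beta) <= r.
    by apply: le_trans wr; have := hQ3 _ Q3n; rewrite mul1r.
  have /andP[h1 h2] := hlarge n x r Kx qr r1; apply/andP; split.
    by apply: le_trans h1; rewrite ler_wpM2r ?powR_ge0// lef_pV2.
  by apply: le_trans h2 _; rewrite ler_wpM2r ?powR_ge0.
- move=> n x r Kx r0 r1; have rs0 : 0 <= r `^ s by exact: powR_ge0.
  have [rq|rq] := leP (q n `^ (- beta)) r.
    have /andP[_ h2] := hlarge n x r Kx rq r1; apply: le_trans h2 _.
    apply: (@le_trans _ _ (CL * CR * r `^ s)); last by rewrite ler_wpM2r.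
    by rewrite ler_pM2l//; apply: ger_powR; rewrite ?r0// ltW.
  have [_ a1 _ _] := qM n; have hb := hB (q n) x r a1 Kx r0 r1 rq.
  rewrite /h ler_pdivrMl// [leRHS]mulrC; apply: le_trans hb _.
  apply: ler_wpM2r; first exact: ltW (k0 n).
  by apply: ler_wpM2r => //; rewrite lerDr ltW.
- move=> n; exists ((k n)^-1 * CR); first by rewrite mulr_ge0// ?invr_ge0 ltW.
  move=> x r Kx r0 r1; rewrite -mulrA ler_wpM2l ?invr_ge0 ?(ltW (k0 n))//.
  apply: le_trans (m_le Kx r0).
  by apply: (content_le cm (borelI (borel_ball _ _) (bE n)) (borel_ball _ _)) => y [].
- move=> n; exists (eta n / (2 * q n)); first by rewrite divr_gt0// mulr_gt0.
  move=> y z [_ Ey] yz; apply: (A_set_near (q0 n) Ey (ltW yz)).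
  rewrite le_eqVlt; apply/orP; left; apply/eqP; field.
  by rewrite lt0r_neq0.
- exact: cm.
- exact: m1.
- exact: m_supp.
- move=> x r Kx r0 r1; apply: le_trans (m_le Kx r0) _.
  rewrite ler_wpM2r ?powR_ge0//; apply: le_trans CLRC.
  by rewrite ler_peMl// ltW.
- move=> x Kx hx; apply: hX => // N.
  have [n nN Ax] := hx (Num.truncn N).+1.
  exists (q n); split=> //; last by have [] := qP n.
  have [_ _ _] := qM n; apply: le_trans.
  by apply/ltW/(lt_le_trans (truncnS_gt N)); rewrite ler_nat.
Qed.

Lemma powR_interpolation (Q r s kappa : R) : 1 <= Q -> 0 < r -> 0 < s -> s <= delta ->
  kappa * s <= beta * delta * (delta - s) ->
  Q `^ (- (beta * delta)) <= r `^ s \/ r `^ delta * Q `^ kappa <= r `^ s.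
Proof.
move=> Q1 r0 s0 sd hk; have Qp : 0 < Q by exact: lt_le_trans Q1.
have X0 : 0 <= ln Q by exact: ln_ge0.
rewrite /powR !(gt_eqF r0) !(gt_eqF Qp) -expRD !ler_expR.
set X := ln Q in X0 *; set Y := ln r.
have [h|h] := leP (- (beta * delta) * X) (s * Y); [by left|right].
rewrite -(ler_pM2l s0).
have : kappa * s * X <= beta * delta * (delta - s) * X by rewrite ler_wpM2r.
have : (delta - s) * (s * Y) <= (delta - s) * (- (beta * delta) * X).
  by rewrite ler_wpM2l ?subr_ge0// ltW.
by move=> *; lra.
Qed.

Lemma key_bound_of_local (tau c s kappa C1 Q1 : R) :
  d%:R^-1 < tau -> tau < alpha -> 0 < c -> c <= 1 -> 0 < s -> s <= delta -> 0 < C1 ->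
  kappa * s <= beta * delta * (delta - s) ->
  (forall Q x (r : R), Q1 <= Q -> K x -> 0 < r -> r <= 1 -> r < Q `^ (- beta) ->
     m (ball x r `&` A_set Q (c * Q `^ (- tau)) theta) <=
       C1 * (r `^ delta * Q `^ kappa + r `^ s) * (Q * (c * Q `^ (- tau)) ^+ d)) ->
  exists C Q2 : R, 0 < C /\
  forall Q x (r : R), Q2 <= Q -> K x -> 0 < r -> r <= 1 -> r < Q `^ (- beta) ->
     m (ball x r `&` A_set Q (c * Q `^ (- tau)) theta)
       <= C * r `^ s * (Q * (c * Q `^ (- tau)) ^+ d).
Proof.
move=> dtau taua c0 c1 s0 sd C10 hk hB.
have CRp : 0 < CR by exact: lt_le_trans CR1.
have CLp : 0 < CL by exact: lt_le_trans CL1.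
have p1 : 0 < alpha - tau by rewrite subr_gt0.
have [Q2 Q21 hQ2] := large_powR p1 c0 ler01.
exists (CL * CR + 2 * C1), (Num.max (Num.max Q0 Q1) Q2); split.
  by rewrite addr_gt0// mulr_gt0.
move=> Q x r; rewrite !ge_max => /andP[/andP[a0 a1] a2] Kx r0 r1 rq.
have Qp := Q0p a0; have Q1' : 1 <= Q by apply: le_trans a0; exact: ltW.
set eta := c * _; have eta0 : 0 < eta by rewrite mulr_gt0 ?powR_gt0.
have k0 : 0 <= Q * eta ^+ d by rewrite mulr_ge0 ?exprn_ge0// ltW.
have rs0 : 0 <= r `^ s by exact: powR_ge0.
have [h|h] := powR_interpolation Q1' r0 s0 sd hk; last first.
  apply: le_trans (hB Q x r a1 Kx r0 r1 rq) _; rewrite ler_wpM2r//.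
  apply: (@le_trans _ _ (2 * C1 * r `^ s)).
    have : 0 <= C1 * (r `^ s - r `^ delta * Q `^ kappa).
      by rewrite mulr_ge0 ?subr_ge0// ltW.
    by move=> ?; lra.
  by rewrite ler_wpM2r// lerDr mulr_ge0// ltW.
have bA := borel_A_set eta Qp.
apply: (@le_trans _ _ (m (ball x (Q `^ (- beta)) `&` A_set Q eta theta))).
  apply: (content_le cm (borelI (borel_ball _ _) bA) (borelI (borel_ball _ _) bA)).
  by move=> y [/ballP xy Ay]; split=> //; apply/ballP; exact: lt_trans rq.
have Qb0 : 0 < Q `^ (- beta) by exact: powR_gt0.
have [||_ h2] := andP (m_count (eta := eta) a0 _ _ Kx Qb0 (lexx _)).
  have h3 := hQ2 _ a2; rewrite mul1r opprB powR_addr// in h3.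
  by rewrite /eta -ler_pdivrMr ?powR_gt0// -powRN opprK mulrC.
  rewrite /eta -[leRHS]mul1r ler_pM ?powR_ge0 ?(ltW c0)//.
  by apply: ler_powR => //; rewrite lerN2 ltW.
apply: le_trans h2 _; rewrite ler_wpM2r// mulrDl.
apply: (@le_trans _ _ (CL * CR * r `^ s)); last first.
  by rewrite lerDl !mulr_ge0// ltW.
rewrite -mulrA ler_wpM2l ?(ltW CLp)//; apply: le_trans (m_le Kx Qb0) _.
by rewrite ler_wpM2l ?(ltW CRp)// -powRrM mulNr.
Qed.

Lemma content_le_cover_fin (I : finType) (F : I -> set 'rV[R]_d) A :
  (forall i, borel (F i)) -> borel A ->
  (forall y, A y -> K y -> exists i, F i y) -> m A <= \sum_i m (F i).
Proof.
move=> bF bA AF.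
pose G (n : nat) : set 'rV[R]_d := oapp (F \o @enum_val I predT) set0 (insub n).
have GE (n : 'I_#|I|) : G n = F (enum_val n) by rewrite /G valK.
rewrite (big_enum_val (A := I)) /=.
rewrite (eq_bigr (fun i : 'I_#|I| => m (G i))); last by move=> i _; rewrite GE.
apply: (content_le_cover_supp (F := G)) => // [i iI|y Ay Ky].
  by rewrite (GE (Ordinal iI)).
have [i Fi] := AF y Ay Ky; exists (enum_rank i) => //.
by rewrite GE enum_rankK.
Qed.

Lemma truncn_eq_dist (a b : R) : 0 <= a -> 0 <= b ->
  Num.truncn a = Num.truncn b -> `|a - b| < 1.
Proof.
move=> /truncn_itv/andP[a1 a2] /truncn_itv/andP[b1 b2] ab.
rewrite ab -natr1 in a1 a2; rewrite -natr1 in b2.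
by rewrite ltr_norml; lra.
Qed.

(* A neighbourhood of width [e] of a hyperplane is covered, inside a ball of
   radius [r], by about [(r / e) ^ (d - 1)] balls of radius comparable to [e]. *)
Lemma slab_mass : exists2 C : R, 0 < C &
  forall (x : 'rV[R]_d) (r e a0 : R) (a : 'rV[R]_d) A, 0 < e -> e <= r -> a != 0 ->
  borel A -> (forall y, A y -> `|x - y| < r /\
    `|a0 + \sum_j (y - x) 0 j * a 0 j| <= e * \sum_j `|a 0 j|) ->
  m A <= C * (r / e) ^+ d.-1 * e `^ delta.
Proof.
have CRp : 0 < CR by exact: lt_le_trans CR1.
exists (3 ^+ d.-1 * (2 * d)%N.+1%:R * (CR * (3 * d%:R) `^ delta)).
  by rewrite !mulr_gt0 ?exprn_gt0 ?powR_gt0 ?mulr_gt0 ?ltr0n.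
move=> x r e a0 a A e0 er aN0 bA hA.
have r0 : 0 < r by exact: lt_le_trans er.
have [i0 ai0] : exists i0, forall j, `|a 0 j| <= `|a 0 i0|.
  have [i _ h] := @arg_maxP _ R 'I_d (Ordinal d0) predT (fun j => `|a 0 j|) isT.
  by exists i => j; exact: h.
have aN : a 0 i0 != 0.
  apply/negP => /eqP a00; move/negP: aN0; apply; apply/eqP/matrixP => i j.
  rewrite ord1 mxE; apply/eqP; rewrite -normr_le0; apply: le_trans (ai0 j) _.
  by rewrite a00 normr0.
have aP : 0 < `|a 0 i0| by rewrite normr_gt0.
pose b j := a 0 j / a 0 i0; have b1 j : `|b j| <= 1.
  by rewrite normrM normfV ler_pdivrMr// mul1r.
have bi0 : b i0 = 1 by rewrite /b divff.
pose L (y : 'rV[R]_d) := a0 / a 0 i0 + \sum_j (y - x) 0 j * b j.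
have Ly y : A y -> `|L y| <= d%:R * e.
  move=> /hA[_ h]; rewrite (_ : L y = (a0 + \sum_j (y - x) 0 j * a 0 j) / a 0 i0).
    rewrite normrM normfV ler_pdivrMr//; apply: le_trans h _.
    rewrite mulrAC [leRHS]mulrC ler_wpM2l ?(ltW e0)//.
    apply: le_trans (ler_sum _ (fun j _ => ai0 j)) _.
    by rewrite sumr_const card_ord mulr_natl.
  rewrite /L mulrDl mulr_suml; congr (_ + _); apply: eq_bigr => j _.
  by rewrite /b mulrA.
pose u (y : 'rV[R]_d) j := ((y - x) 0 j + r) / e.
pose v (y : 'rV[R]_d) := (L y + d%:R * e) / e.
have u0 y j : A y -> 0 <= u y j < 2 * r / e.
  move=> /hA[yx _]; have : `|(x - y) 0 j| < r by apply: le_lt_trans yx; exact: rV_coord_le.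
  rewrite (_ : (x - y) 0 j = - ((y - x) 0 j)); last by rewrite !mxE opprB.
  rewrite normrN ltr_norml => /andP[h1 h2].
  rewrite /u divr_ge0 ?(ltW e0)//=; last by lra.
  by rewrite ltr_pM2r ?invr_gt0//; lra.
have v0 y : A y -> 0 <= v y <= (2 * d)%N%:R.
  move=> /Ly; rewrite ler_norml => /andP[h1 h2].
  rewrite /v divr_ge0 ?(ltW e0)//=; last by lra.
  by rewrite ler_pdivrMr// natrM; lra.
pose N := Num.truncn (2 * r / e); pose M := (2 * d)%N.
pose key := ({ffun {j : 'I_d | j != i0} -> 'I_N.+1} * 'I_M.+1)%type.
pose f (y : 'rV[R]_d) : key :=
  ([ffun j => inord (Num.truncn (u y (val j)))], inord (Num.truncn (v y))).
have fu y z j : A y -> A z -> f y = f z -> j != i0 -> `|u y j - u z j| < 1.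
  move=> Ay Az [fyz _] ji0.
  have /andP[uy0 uy1] := u0 y j Ay; have /andP[uz0 uz1] := u0 z j Az.
  have := congr1 (fun g : {ffun _ -> _} => val (g (exist _ j ji0))) fyz.
  rewrite !ffunE /= !inordK ?ltnS ?le_truncn ?(ltW uy1) ?(ltW uz1)// => /eqP h.
  by apply: truncn_eq_dist => //; exact/eqP.
have fv y z : A y -> A z -> f y = f z -> `|v y - v z| < 1.
  have tv t : A t -> (Num.truncn (v t) <= M)%N.
    by move=> /v0/andP[_ /le_truncn]; rewrite natrK.
  move=> Ay Az [_ fyz]; have /andP[vy0 vy1] := v0 y Ay; have /andP[vz0 vz1] := v0 z Az.
  have := congr1 val fyz.
  rewrite /= !inordK ?ltnS ?tv// => /eqP h.
  by apply: truncn_eq_dist => //; exact/eqP.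
have d1 : 1 <= d%:R :> R by rewrite ler1n.
have close y z : A y -> A z -> f y = f z -> `|y - z| < 3 * d%:R * e.
  move=> Ay Az fyz.
  have cl j : j != i0 -> `|(y - z) 0 j| <= e.
    move=> ji0; have := fu y z j Ay Az fyz ji0.
    rewrite /u -mulrBl normrM normfV (gtr0_norm e0) ltr_pdivrMr// mul1r.
    by rewrite !mxE => h; apply: le_trans (ltW h); rewrite le_eqVlt; apply/orP; left;
      apply/eqP; congr `|_|; ring.
  have cl0 : `|(y - z) 0 i0| <= (1 + d%:R) * e.
    have h := fv y z Ay Az fyz.
    rewrite /v -mulrBl normrM normfV (gtr0_norm e0) ltr_pdivrMr// mul1r in h.
    have -> : (y - z) 0 i0 = (L y - L z) - \sum_(j | j != i0) (y - z) 0 j * b j.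
      rewrite /L opprD addrACA subrr add0r -sumrB.
      rewrite (eq_bigr (fun j => (y - z) 0 j * b j)); last first.
        by move=> j _; rewrite -mulrBl !mxE; congr (_ * _); ring.
      by rewrite (bigD1 i0)//= addrK bi0 mulr1.
    apply: le_trans (ler_normB _ _) _; rewrite mulrDl mul1r lerD//.
      by move: h; rewrite opprD addrACA subrr addr0 => /ltW.
    apply: le_trans (ler_norm_sum _ _ _) _.
    apply: (@le_trans _ _ (\sum_(j < d) e)); last first.
      by rewrite sumr_const card_ord mulr_natl.
    rewrite [leRHS](bigD1 i0)//= -[leLHS]add0r lerD ?(ltW e0)//.
    apply: ler_sum => j ji0; rewrite normrM -[leRHS]mulr1.
    by rewrite ler_pM// cl.
  apply: (@le_lt_trans _ _ ((1 + d%:R) * e)); last by rewrite ltr_pM2r//; lra.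
  apply: rV_norm_le => [|j]; first by rewrite mulr_ge0// ?ltW// addr_ge0.
  have [->//|ji0] := eqVneq j i0; apply: le_trans (cl j ji0) _.
  by rewrite ler_peMl ?(ltW e0)// lerDl.
have /choice[F FP] : forall k : key, exists F : set 'rV[R]_d, [/\ borel F,
    m F <= CR * (3 * d%:R * e) `^ delta & forall y, A y -> K y -> f y = k -> F y].
  move=> k; have [[y [Ay Ky fy]]|no] := pselect (exists y, [/\ A y, K y & f y = k]).
    exists (ball y (3 * d%:R * e)); split; first exact: borel_ball.
      by apply: m_le => //; rewrite !mulr_gt0// ltr0n.
    by move=> z Az Kz fz; apply/ballP; apply: close => //; rewrite fz.
  exists set0; split; first exact: measurable0.
    by rewrite content_set0// mulr_ge0 ?powR_ge0 ?ltW.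
  by move=> y Ay Ky fy; apply: no; exists y.
apply: le_trans (@content_le_cover_fin key F A _ bA _) _.
- by move=> k; have [] := FP k.
- by move=> y Ay Ky; exists (f y); have [_ _] := FP (f y); apply.
apply: (@le_trans _ _ (\sum_(k : key) CR * (3 * d%:R * e) `^ delta)).
  by apply: ler_sum => k _; have [] := FP k.
rewrite sumr_const card_prod card_ffun !card_ord card_sig.
have -> : #|[pred j : 'I_d | j != i0]| = d.-1 by rewrite (cardC1 i0) card_ord.
rewrite -[leLHS]mulr_natl natrM natrX.
rewrite [_ `^ delta]powRM ?(ltW e0) ?mulr_ge0//.
have hN : N.+1%:R ^+ d.-1 <= 3 ^+ d.-1 * (r / e) ^+ d.-1 :> R.
  have re1 : 1 <= r / e by rewrite ler_pdivlMr// mul1r.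
  have N0 : N%:R <= 2 * r / e.
    by rewrite truncn_le divr_ge0 ?mulr_ge0 ?(ltW r0) ?(ltW e0).
  have N1 : N.+1%:R <= 3 * (r / e).
    by rewrite -natr1; rewrite -mulrA in N0; lra.
  by rewrite -exprMn; apply: lerXn2r => //; rewrite nnegrE ?ler0n// mulr_ge0// (le_trans _ re1).
set X := (3 * d%:R) `^ delta; set Y := e `^ delta.
rewrite (_ : _ * (CR * (X * Y)) = N.+1%:R ^+ d.-1 * (M.+1%:R * CR * X * Y)); last by ring.
rewrite [leRHS](_ : _ = 3 ^+ d.-1 * (r / e) ^+ d.-1 * (M.+1%:R * CR * X * Y)); last first.
  by rewrite /M; ring.
by apply: ler_wpM2r => //; rewrite !mulr_ge0 ?powR_ge0// ltW.
Qed.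

Lemma homogeneous_small_ball : theta = 0 -> exists2 C : R, 0 < C &
  forall (x : 'rV[R]_d) (r Q eta : R), 0 < Q -> 0 < eta -> eta / Q <= r ->
  ((1 + d)`!)%:R * (2 * Q * (3 * Q * r) ^+ d) < 1 ->
  m (ball x r `&` A_set Q eta theta)
    <= C * (r / (eta / Q)) ^+ d.-1 * (eta / Q) `^ delta.
Proof.
move=> theta0; have [C C0 hC] := slab_mass; exists C => // x r Q eta Qp eta0 er small.
have e0 : 0 < eta / Q by rewrite divr_gt0.
have r0 : 0 < r by exact: lt_le_trans er.
have b0 : 0 <= 3 * Q * r by rewrite !mulr_ge0// ltW.
have [a0 [a [aN0 ha]]] := simplex_lemma x Qp b0 d0 small.
apply: (hC x r (eta / Q) a0 a) => //.
  exact: (borelI (borel_ball _ _) (borel_A_set _ Qp)).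
move=> y [/ballP xy /A_setP[q [p [h1 h2 h3]]]]; split=> //.
have q0 : 0 < q%:~R :> R by exact: lt_le_trans h1.
rewrite theta0 subr0 in h3.
have eQ : eta <= Q * r by rewrite mulrC -ler_pdivrMr.
have := ha q p h1 h2; set w := map_mx intr p in h3 *.
have -> : w - q%:~R *: x = q%:~R *: (y - x) - (q%:~R *: y - w).
  by rewrite scalerBr opprB [RHS]addrC addrA subrK.
move=> /(_ _)/eqP; rewrite (eq_bigr (fun j => q%:~R * ((y - x) 0 j * a 0 j) -
    (q%:~R *: y - w) 0 j * a 0 j)); last first.
  by move=> j _; rewrite [X in X * _]mxE [X in (X + _) * _]mxE
    [X in (_ + X) * _]mxE mulrBl mulrA.
rewrite sumrB -mulr_sumr addrA [a0 * _]mulrC -mulrDr subr_eq0 => h.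
have {h} /eqP h : q%:~R * (a0 + \sum_j (y - x) 0 j * a 0 j)
    == \sum_j (q%:~R *: y - w) 0 j * a 0 j.
  apply: h; apply: le_trans (ler_normB _ _) _; rewrite normrZ gtr0_norm//.
  have : q%:~R * `|y - x| <= 2 * Q * r.
    by rewrite distrC ler_pM ?(ltW q0)// ltW.
  by move=> h; lra.
rewrite -(ler_pM2l q0) -{1}(gtr0_norm q0) -normrM h.
apply: le_trans (ler_norm_sum _ _ _) _.
apply: (@le_trans _ _ (eta * \sum_j `|a 0 j|)).
  rewrite mulr_sumr; apply: ler_sum => j _; rewrite normrM ler_wpM2r//.
  by apply: le_trans (rV_coord_le _ _) _; exact: ltW.
rewrite mulrA ler_wpM2r ?sumr_ge0// mulrA ler_pdivlMr// mulrC.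
by rewrite ler_wpM2r// ltW.
Qed.

Lemma normalising_factor (tau c Q : R) : 0 < Q ->
  Q * (c * Q `^ (- tau)) ^+ d = c ^+ d * Q `^ (1 - tau * d%:R).
Proof.
move=> Qp; rewrite exprMn exprn_powR powR_addr// powRr1 ?ltW// mulNr; ring.
Qed.

Lemma trivial_local_bound (tau c s : R) : 0 < c ->
  exists C1 Q1 : R, 0 < C1 /\
  forall Q x (r : R), Q1 <= Q -> K x -> 0 < r -> r <= 1 -> r < Q `^ (- beta) ->
     m (ball x r `&` A_set Q (c * Q `^ (- tau)) theta) <=
       C1 * (r `^ delta * Q `^ (tau * d%:R - 1) + r `^ s) *
       (Q * (c * Q `^ (- tau)) ^+ d).
Proof.
move=> c0; have CRp : 0 < CR by exact: lt_le_trans CR1.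
have cd0 : 0 < c ^+ d by rewrite exprn_gt0.
exists (CR / c ^+ d), Q0; split; first by rewrite divr_gt0.
move=> Q x r /Q0p Qp Kx r0 _ _; have bA := borel_A_set (c * Q `^ (- tau)) Qp.
apply: (@le_trans _ _ (m (ball x r))).
  by apply: (content_le cm (borelI (borel_ball _ _) bA) (borel_ball _ _)) => y [].
apply: le_trans (m_le Kx r0) _; rewrite normalising_factor//.
rewrite (_ : _ * (c ^+ d * _) = CR * ((r `^ delta * Q `^ (tau * d%:R - 1) + r `^ s) *
  Q `^ (1 - tau * d%:R))); last by field; rewrite lt0r_neq0.
rewrite ler_pM2l// mulrDl -mulrA -powR_addr// addrA subrK subrr powRr0 mulr1.
by rewrite lerDl mulr_ge0 ?powR_ge0.
Qed.

Lemma homogeneous_local_bound (tau c s : R) : theta = 0 ->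
  0 < c -> c <= 1 -> d%:R^-1 < tau -> 0 < s ->
  s <= delta + (1 - tau * d%:R) / (1 + tau) ->
  d%:R - 1 <= delta + (1 - tau * d%:R) / (1 + tau) ->
  exists C1 Q1 : R, 0 < C1 /\
  forall Q x (r : R), Q1 <= Q -> K x -> 0 < r -> r <= 1 -> r < Q `^ (- beta) ->
     m (ball x r `&` A_set Q (c * Q `^ (- tau)) theta) <=
       C1 * (r `^ delta * Q `^ ((tau - d%:R^-1) * (2 * d%:R - delta - 1)) + r `^ s) *
       (Q * (c * Q `^ (- tau)) ^+ d).
Proof.
set s0 := delta + _ / _ => theta0 c0 c1 dtau sp ss0 ds0.
have CRp : 0 < CR by exact: lt_le_trans CR1.
have dR0 : 0 < d%:R :> R by rewrite ltr0n.
have dp : 0 < d%:R^-1 :> R by rewrite invr_gt0.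
have dd1 : d%:R^-1 * d%:R = 1 :> R by rewrite mulVf// gt_eqF.
have tau0 : 0 < tau by exact: lt_trans dtau.
have taud : 0 < tau * d%:R - 1 by rewrite subr_gt0 -ltr_pdivrMr// mul1r.
have s0E : (1 + tau) * (delta - s0) = tau * d%:R - 1.
  by rewrite /s0; field; rewrite gt_eqF// addr_gt0.
have ds00 : 0 <= delta - s0.
  have t1 : 0 < 1 + tau by rewrite addr_gt0.
  by rewrite -(pmulr_rge0 _ t1) s0E ltW.
have cd0 : 0 < c ^+ d by rewrite exprn_gt0.
have [C C0 hC] := homogeneous_small_ball theta0.
pose F : R := ((1 + d)`!)%:R * 2 * 3 ^+ d.
have F0 : 0 <= F by rewrite !mulr_ge0// exprn_ge0.
have [c' [c'0 c'1 hc']] := small_powR dR0 (ltac:(lra) : 0 < 2^-1 :> R) F0.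
have c'd : F * c' ^+ d < 1.
  by have := hc' c' c'0 (lexx _); rewrite powR_mulrn ?(ltW c'0)// => h; lra.
pose E : R := 1 + d%:R^-1.
have p1 : 0 < tau - d%:R^-1 by rewrite subr_gt0.
have [Q2 Q21 hQ2] := large_powR p1 c'0 ler01.
pose Cn := CR * CR * 4 `^ delta * C * (c / c') `^ (delta - (d%:R - 1)).
have Cn0 : 0 < Cn by rewrite !mulr_gt0 ?powR_gt0// divr_gt0.
exists ((CR + C + Cn) / c ^+ d), (Num.max Q0 Q2); split.
  by rewrite divr_gt0// !addr_gt0.
move=> Q x r; rewrite ge_max => /andP[a0 a2] Kx r0 r1 _.
have Qp := Q0p a0; have Q1 : 1 <= Q by apply: le_trans a0; exact: ltW.
set eta := c * _; have eta0 : 0 < eta by rewrite mulr_gt0 ?powR_gt0.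
have bA := borel_A_set eta Qp.
pose e := eta / Q; have e0 : 0 < e by rewrite divr_gt0.
have eE : e = c * Q `^ (- (1 + tau)).
  rewrite /e /eta opprD powR_addr// powR_inv1 ?(ltW Qp)//; ring.
pose r' := c' * Q `^ (- E); have r'0 : 0 < r' by rewrite mulr_gt0 ?powR_gt0.
have er' : e <= r'.
  have h := hQ2 _ a2; rewrite mul1r in h.
  rewrite eE (_ : - (1 + tau) = - (tau - d%:R^-1) + - E); last by rewrite /E; ring.
  rewrite powR_addr// mulrA; apply: ler_wpM2r; first exact: powR_ge0.
  by apply: le_trans h; rewrite ler_piMl ?powR_ge0.
have smallr (t : R) : 0 < t -> t <= r' -> ((1 + d)`!)%:R * (2 * Q * (3 * Q * t) ^+ d) < 1.
  move=> t0 tr; apply: le_lt_trans c'd.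
  have : (3 * Q * t) ^+ d <= (3 * Q * r') ^+ d.
    have q3 : 0 < 3 * Q by rewrite mulr_gt0.
    apply: lerXn2r; [exact: mulr_ge0 (ltW q3) (ltW t0)|
      exact: mulr_ge0 (ltW q3) (ltW r'0)|by rewrite ler_pM2l].
  have -> : (3 * Q * r') ^+ d = 3 ^+ d * c' ^+ d * Q^-1.
    rewrite /r' (_ : 3 * Q * _ = 3 * c' * (Q `^ (- d%:R^-1))); last first.
      rewrite /E opprD powR_addr// powR_inv1 ?(ltW Qp)//; field.
      by rewrite gt_eqF.
    by rewrite !exprMn exprn_powR mulNr dd1 powR_inv1// ltW.
  move=> h; rewrite (_ : _ * (2 * Q * _) = ((1 + d)`!)%:R * 2 * ((3 * Q * t) ^+ d * Q));
    last by ring.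
  by rewrite /F -[leRHS]mulrA; apply: ler_wpM2l; rewrite ?mulr_ge0// -ler_pdivlMr.
have cdc k : 0 <= k -> k <= CR + C + Cn -> forall Y, 0 <= Y ->
   k * Y * Q `^ (1 - tau * d%:R) <= (CR + C + Cn) / c ^+ d * Y * (Q * eta ^+ d).
  move=> k0 kC Y Y0; rewrite normalising_factor//.
  rewrite [leRHS](_ : _ = (CR + C + Cn) * Y * Q `^ (1 - tau * d%:R)); last first.
    by field; rewrite gt_eqF.
  by rewrite ler_wpM2r ?powR_ge0// ler_wpM2r.
have rs0 : 0 <= r `^ s by exact: powR_ge0.
have rk0 : 0 <= r `^ delta * Q `^ ((tau - d%:R^-1) * (2 * d%:R - delta - 1)).
  by rewrite mulr_ge0 ?powR_ge0.
(* In the two cases [r <= r'] the bound obtained is a multiple of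
   [r ^ s0 * e ^ (delta - s0)]. *)
have eds : e `^ (delta - s0) <= Q `^ (1 - tau * d%:R).
  rewrite eE powRM ?(ltW c0) ?powR_ge0// -powRrM mulNr s0E opprB.
  rewrite ler_piMl ?powR_ge0// -[leRHS](_ : 1 `^ (delta - s0) = 1).
    by apply: powR_le_base => //; exact: ltW.
  by rewrite powR1.
have fin k : 0 <= k -> k <= CR + C + Cn ->
    m (ball x r `&` A_set Q eta theta) <= k * (r `^ s0 * e `^ (delta - s0)) ->
    m (ball x r `&` A_set Q eta theta) <= (CR + C + Cn) / c ^+ d *
      (r `^ delta * Q `^ ((tau - d%:R^-1) * (2 * d%:R - delta - 1)) + r `^ s) *
      (Q * eta ^+ d).
  move=> k0 kC h; apply: le_trans h _.
  apply: le_trans (cdc k k0 kC _ (addr_ge0 rk0 rs0)).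
  rewrite -mulrA ler_wpM2l// ler_pM ?powR_ge0//.
  apply: (@le_trans _ _ (r `^ s)); last by rewrite lerDr.
  by apply: ger_powR; rewrite // r0.
have [rr'|r'r] := leP r r'; [have [er|re] := leP e r|].
- apply: (fin C); [exact: ltW|lra|].
  apply: le_trans (hC x r Q eta Qp eta0 er (smallr r r0 rr')) _.
  rewrite -mulrA ler_pM2l// -/e -powR_mulrn; last exact: divr_ge0 (ltW r0) (ltW e0).
  rewrite -subn1 natrB// [(r / e) `^ _]powRM ?invr_ge0 ?(ltW r0) ?(ltW e0)// powR_invl ?(ltW e0)//.
  rewrite -mulrA -(powR_addr _ _ e0).
  have rE : r `^ s0 = r `^ (d%:R - 1) * r `^ (s0 - (d%:R - 1)).
    by rewrite -powR_addr// subrKC.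
  have eE2 : e `^ (- (d%:R - 1) + delta) = e `^ (s0 - (d%:R - 1)) * e `^ (delta - s0).
    by rewrite -powR_addr//; congr (_ `^ _); ring.
  rewrite rE eE2 -[leRHS]mulrA ler_pM2l ?powR_gt0// ler_wpM2r ?powR_ge0//.
  by apply: powR_le_base; rewrite ?subr_ge0// ltW.
- apply: (fin CR); [exact: ltW|lra|].
  apply: (@le_trans _ _ (m (ball x r))).
    by apply: (content_le cm (borelI (borel_ball _ _) bA) (borel_ball _ _)) => y [].
  apply: le_trans (m_le Kx r0) _; rewrite ler_pM2l//.
  have -> : r `^ delta = r `^ s0 * r `^ (delta - s0) by rewrite -powR_addr// subrKC.
  by rewrite ler_pM2l ?powR_gt0//; apply: powR_le_base => //; exact: ltW.
have [n [z [Xz sz netz]]] := compact_net cK (@subIsetl _ K (ball x r)) r'0.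
have nle : n%:R <= CR * CR * 4 `^ delta * (r / r') `^ delta.
  have r'2 : 0 < r' / 2 by rewrite divr_gt0.
  have : n%:R * (CR^-1 * (r' / 2) `^ delta) <= CR * (2 * r) `^ delta.
    have r20 : 0 < 2 * r by rewrite mulr_gt0.
    apply: le_trans (m_le Kx r20).
    apply: (@le_trans _ _ (\sum_(i < n) m (ball (z i) (r' / 2)))).
      rewrite mulr_natl -[n in _ *+ n]card_ord -sumr_const; apply: ler_sum => i _.
      have [Kz _] := Xz i (ltn_ord i); apply: m_ge => //.
      by have : r' <= 1 by [exact: le_trans (ltW r'r) r1]; move=> h; lra.
    rewrite -(content_bigsetU cm (F := fun i => ball (z i) (r' / 2))).
    - apply: (content_le cm _ (borel_ball _ _)).
        apply: (borel_bigsetU (F := fun i => ball (z i) (r' / 2))) => i _.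
        exact: borel_ball.
      rewrite -(bigcup_mkord n (fun i => ball (z i) (r' / 2))) => y [i /= ni /ballP zy].
      have [_ /ballP xz] := Xz i ni; apply/ballP; rewrite -(subrKA (z i)).
      apply: le_lt_trans (ler_normD _ _) _; lra.
    - by move=> i _; exact: borel_ball.
    - move=> i j ijn; apply/seteqP; split=> // y [/ballP yi /ballP yj].
      have := sz i j ijn; rewrite leNgt => /negP; apply.
      rewrite (splitr r') -(subrKA y); apply: le_lt_trans (ler_normD _ _) _.
      by rewrite ltrD// distrC.
  rewrite -ler_pdivlMr ?mulr_gt0 ?invr_gt0 ?powR_gt0// => h; apply: le_trans h _.
  rewrite le_eqVlt; apply/orP; left; apply/eqP.
  rewrite invfM invrK -powRN -powR_invl ?(ltW r'2)//.
  rewrite (_ : _ * (CR * _) = CR * CR * ((2 * r) `^ delta * (r' / 2)^-1 `^ delta));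
    last by ring.
  have -> : (2 * r) `^ delta * (r' / 2)^-1 `^ delta = 4 `^ delta * (r / r') `^ delta.
    have h1 : 0 <= (r' / 2)^-1 by rewrite invr_ge0 ltW.
    have h2 : 0 <= r / r' by exact: divr_ge0 (ltW r0) (ltW r'0).
    have h3 : 0 <= 2 * r by rewrite mulr_ge0// ltW.
    rewrite -(powRM delta h3 h1) -(powRM delta (ler0n R 4) h2).
    by congr powR; field; rewrite gt_eqF.
  ring.
have cover : m (ball x r `&` A_set Q eta theta) <=
    n%:R * (C * (r' / e) ^+ d.-1 * e `^ delta).
  apply: le_trans (@content_le_cover_supp n
    (fun i => ball (z i) r' `&` A_set Q eta theta) _ _ (borelI (borel_ball _ _) bA) _) _.
  - by move=> i _; exact: (borelI (borel_ball _ _) bA).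
  - by move=> y [By Ay] Ky; have [|i ni Bi] := netz y; [split|exists i].
  rewrite mulr_natl -[n in _ *+ n]card_ord -sumr_const; apply: ler_sum => i _.
  exact: (hC (z i) r' Q eta Qp eta0 er' (smallr r' r'0 (lexx _))).
apply: le_trans cover _.
apply: (@le_trans _ _ (Cn * (r `^ delta * Q `^ ((tau - d%:R^-1) * (2 * d%:R - delta - 1)))
    * Q `^ (1 - tau * d%:R))); last first.
  apply: le_trans (cdc Cn (ltW Cn0) _ _ (addr_ge0 rk0 rs0)); last by lra.
  by rewrite ler_wpM2r ?powR_ge0// ler_pM2l// lerDl.
apply: le_trans (ler_wpM2r _ nle) _.
  rewrite !mulr_ge0 ?powR_ge0 ?(ltW C0)// exprn_ge0//.
  exact: divr_ge0 (ltW r'0) (ltW e0).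
rewrite le_eqVlt; apply/orP; left; apply/eqP.
have eE' : e = (c / c') * Q `^ (- (tau - d%:R^-1)) * r'.
  rewrite /r' (_ : _ * _ * (c' * _) = c * (Q `^ (- (tau - d%:R^-1)) * Q `^ (- E))); last first.
    by field; rewrite gt_eqF.
  by rewrite -powR_addr// eE; congr (_ * _ `^ _); rewrite /E; ring.
rewrite -powR_mulrn; last exact: divr_ge0 (ltW r'0) (ltW e0).
rewrite -subn1 natrB//.
set D : R := d%:R - 1; pose p : R := delta - D.
have cc0 : 0 <= c / c' by exact: divr_ge0 (ltW c0) (ltW c'0).
have ep : e `^ p = (c / c') `^ p * Q `^ (- (tau - d%:R^-1) * p) * r' `^ p.
  rewrite {1}eE' (powRM p (mulr_ge0 cc0 (powR_ge0 _ _)) (ltW r'0)).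
  by rewrite (powRM p cc0 (powR_ge0 _ _)) -powRrM.
have h1 : (r / r') `^ delta = r `^ delta * r' `^ (- delta).
  by rewrite powRM ?invr_ge0 ?(ltW r0) ?(ltW r'0)// powR_invl// ltW.
have h2 : (r' / e) `^ D = r' `^ D * e `^ (- D).
  by rewrite powRM ?invr_ge0 ?(ltW r'0) ?(ltW e0)// powR_invl// ltW.
have h3 : r' `^ (- delta) * r' `^ D * r' `^ p = 1.
  by rewrite -!powR_addr// (_ : _ + p = 0) ?powRr0// /p; ring.
have h4 : e `^ (- D) * e `^ delta = e `^ p.
  by rewrite -powR_addr//; congr (_ `^ _); rewrite /p; ring.
have h5 : Q `^ ((tau - d%:R^-1) * (2 * d%:R - delta - 1)) * Q `^ (1 - tau * d%:R) =
    Q `^ (- (tau - d%:R^-1) * p).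
  by rewrite -powR_addr//; congr (_ `^ _); rewrite /p /D; field; rewrite gt_eqF.
rewrite h1 h2 -[RHS]mulrA -[_ * _ * Q `^ (1 - _)]mulrA h5 /Cn -/D -/p.
transitivity (CR * CR * 4 `^ delta * C * r `^ delta * (r' `^ (- delta) * r' `^ D) *
  (e `^ (- D) * e `^ delta)); first by ring.
rewrite h4 ep -[in RHS](mul1r (Q `^ _)) -h3; ring.
Qed.

Section ApproximableSets.
Variable psi : nat -> R.
Hypothesis psi_mono : monotonic psi.

Lemma W_set_measure_pinfty (tau c s kappa : R) :
  d%:R^-1 < tau -> tau < alpha -> 0 < c -> 0 < s -> s < delta ->
  kappa * s <= beta * delta * (delta - s) ->
  infinite_set [set q : nat | (0 < q)%N /\ c * q%:R `^ (- tau) <= psi q] ->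
  (forall c1 : R, 0 < c1 -> c1 <= 1 -> exists C1 Q1 : R, 0 < C1 /\
    forall Q x (r : R), Q1 <= Q -> K x -> 0 < r -> r <= 1 -> r < Q `^ (- beta) ->
     m (ball x r `&` A_set Q (c1 * Q `^ (- tau)) theta) <=
       C1 * (r `^ delta * Q `^ kappa + r `^ s) * (Q * (c1 * Q `^ (- tau)) ^+ d)) ->
  hausdorff_measure s (K `&` W_set psi theta) = +oo%E.
Proof.
move=> dtau taua c0 s0 sd hk inf hloc.
have tau0 : 0 < tau by apply: lt_trans dtau; rewrite invr_gt0 ltr0n.
have [c1 [c10 c11 hQ]] := dyadic_lower_bound psi_mono c0 tau0 inf.
have [C1 [Q1 [C10 hl]]] := hloc c1 c10 c11.
have [C [Q2 [C0 hb]]] :=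
  key_bound_of_local dtau taua c10 c11 s0 (ltW sd) C10 hk hl.
apply: (limsup_measure_pinfty dtau taua c10 c11 s0 sd C0 hb hQ).
move=> x Kx hx; split=> //; apply: unbounded_infinite => n.
have [Q [nQ [Qp hpsi] [q [h1 h2 h3]]]] := hx n%:R.
have q0 : (0 < q)%R by rewrite -(ltr0z R); exact: lt_le_trans h1.
have qE : q%:~R = (`|q|%N)%:R :> R by rewrite -[in LHS](gez0_abs (ltW q0)).
rewrite qE in h1 h2 h3; exists `|q|%N; first by rewrite -(ler_nat R) (le_trans nQ).
split; first by rewrite absz_gt0 gt_eqF.
exact: lt_le_trans h3 (hpsi _ h1 h2).
Qed.

Lemma W_set_measure0 (t s : R) : d%:R^-1 < t -> t < alpha -> 0 < s ->
  delta + (1 - t * d%:R) / (1 + t) < s ->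
  (exists n, forall q, (n <= q)%N -> psi q < q%:R `^ (- t)) ->
  hausdorff_measure s (K `&` W_set psi theta) = 0%E.
Proof.
move=> dt ta s0 hs [n hn]; have t0 : 0 < t.
  by apply: lt_trans dt; rewrite invr_gt0 ltr0n.
apply: (limsup_measure0 dt ta s0 hs) => [|x [_ /infinite_unbounded xW] N].
  by move=> x [].
have [q nq [q0 hq]] := xW (maxn n (2 ^ N)).
move: nq; rewrite geq_max => /andP[nq Nq].
exists (trunc_log 2 q); first exact: trunc_log_max.
have /andP[q1 q2] := @trunc_log_bounds 2 q isT q0.
have qR : (2 ^+ trunc_log 2 q : R) <= q%:R by rewrite -natrX ler_nat.
have p0 : 0 < 2 ^+ trunc_log 2 q :> R by rewrite exprn_gt0.
exists (Posz q); split => //.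
- by rewrite -pmulrn -exprS -natrX ltr_nat.
- rewrite -pmulrn; apply: lt_le_trans hq _; apply: le_trans (ltW (hn q nq)) _.
  rewrite !powRN lef_pV2 ?posrE ?powR_gt0//; last by rewrite ltr0n.
  by apply: powR_le_base => //; exact: ltW.
Qed.

End ApproximableSets.

End Counting.
(** * The exponents *)

Section Exponents.
Context {R : realType}.
Implicit Types D delta alpha beta t s : R.

Lemma alpha_bound D delta alpha beta : 0 < delta -> beta < 1 -> 0 < alpha ->
  (alpha%:E < (1 + delta - beta * delta)%:E / (D - delta)%:E)%E ->
  delta <= D /\ alpha * (D - delta) < 1 + delta - beta * delta.
Proof.
move=> delta0 beta1 alpha0 h.
have p : 0 < 1 + delta - beta * delta.
  have : 0 < (1 - beta) * delta by rewrite mulr_gt0// subr_gt0.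
  by move=> ?; lra.
rewrite inver in h; have [D0|Dn] := eqVneq (D - delta) 0.
  by rewrite D0 mulr0; split=> //; lra.
rewrite (negbTE Dn) -EFinM lte_fin in h.
have [Dp|Dm] := ltP 0 (D - delta).
  by split; [lra|rewrite -ltr_pdivlMr].
exfalso; have : (1 + delta - beta * delta) / (D - delta) <= 0.
  by rewrite pmulr_rle0// invr_le0.
by move=> ?; lra.
Qed.

Lemma exponent_scaled D delta t : 0 < t ->
  (1 + t) * (delta + (1 + D) / (1 + t) - D) = 1 + delta - t * (D - delta).
Proof. by move=> t0; field; rewrite gt_eqF// addr_gt0. Qed.

Lemma exponentE D delta t : 0 < t ->
  delta + (1 - t * D) / (1 + t) = delta + (1 + D) / (1 + t) - D.
Proof. by move=> t0; field; rewrite gt_eqF// addr_gt0. Qed.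

Lemma exponent_gt D delta alpha beta t : 0 < t -> t < alpha -> delta <= D ->
  alpha * (D - delta) < 1 + delta - beta * delta ->
  beta * delta < (1 + t) * (delta + (1 + D) / (1 + t) - D).
Proof.
move=> t0 ta dD h; rewrite exponent_scaled//.
have : 0 <= (alpha - t) * (D - delta) by rewrite mulr_ge0 ?subr_ge0// ltW.
by move=> ?; lra.
Qed.

End Exponents.

Theorem theorem1p3 (R : realType) (d : nat) (hd : (1 <= d)%N)
    (K : set 'rV[R]_d) (hK : compact K)
    (mu : probability (borel_rV R d) R) (hmuK : mu K = 1%E)
    (delta : R) (hdelta : 0 < delta) (hreg : ahlfors_regular mu K delta)
    (theta : 'rV[R]_d) (alpha beta : R)
    (hbeta0 : 0 < beta) (hbeta1 : beta < 1)
    (halpha0 : d%:R^-1 < alpha)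
    (* in \bar R, a / 0 = +oo for a > 0: no upper bound when delta = d *)
    (halpha1 : (alpha%:E <
       (1 + delta - beta * delta)%:E / (d%:R - delta)%:E)%E)
    (hlc : local_counting mu alpha beta theta)
    (psi : nat -> R) (hpsi0 : forall q : nat, (0 < q)%N -> 0 <= psi q)
    (hpsi : monotonic psi) :
  (forall t : R, lower_order psi = t%:E -> d%:R^-1 < t -> t < alpha ->
     (hausdorff_dim (K `&` W_set psi theta)
        <= (delta + (d%:R + 1) / (1 + t) - d%:R)%:E)%E /\
     ((Num.min
         (delta - (t * d%:R - 1) * (delta + (1 + d%:R) / (1 + t) - d%:R)
                    / (beta * delta))
         (delta + (1 + d%:R) / (1 + t) - d%:R))%:E
        <= hausdorff_dim (K `&` W_set psi theta))%E) /\
  (d%:R - 1 < delta -> theta = 0 ->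
   forall c tau : R, 0 < c -> d%:R^-1 < tau ->
     (tau%:E < mine alpha%:E
        ((delta + 2 - d%:R)%:E / (2 * d%:R - delta - 1)%:E))%E ->
     infinite_set [set q : nat | (0 < q)%N /\ c * q%:R `^ (- tau) <= psi q] ->
     let s := Num.min
       (delta - (tau - d%:R^-1) * (2 * d%:R - delta - 1)
                  * (delta + (1 + d%:R) / (1 + tau) - d%:R) / (beta * delta))
       (delta + (1 + d%:R) / (1 + tau) - d%:R) in
     hausdorff_measure s (K `&` W_set psi 0) = +oo%E /\
     (s%:E <= hausdorff_dim (K `&` W_set psi 0))%E).
Proof.
have [Q0 [CL [Q01 CL1 count]]] := mass_counting hd hlc.
have [CR [CR1 reg]] := mass_regular hd hK hmuK hdelta hreg hbeta0 halpha0 hlc.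
have Ksup := K_sub_support hd hK hmuK hdelta hreg hbeta0 halpha0 hlc.
have cm := is_content_mass mu; have m1 := massT mu.
have msupp := @mass_supp _ _ mu K hK hmuK.
have mle x (r : R) : K x -> 0 < r -> mass mu (ball x r) <= CR * r `^ delta.
  by move=> Kx r0; have [] := reg x r Kx r0.
have mge x (r : R) : K x -> 0 < r -> r <= 1 -> CR^-1 * r `^ delta <= mass mu (ball x r).
  by move=> Kx r0; have [_] := reg x r Kx r0.
have mcount (Q eta : R) (h1 : Q0 <= Q) h2 h3 x (r : R) (Kx : K x) (r0 : 0 < r) hr :=
  count Q eta h1 h2 h3 x r (Ksup x Kx) r0 hr.
have dR0 : 0 < d%:R :> R by rewrite ltr0n.
have dR1 : 1 <= d%:R :> R by rewrite ler1n.
have dp : 0 < d%:R^-1 :> R by rewrite invr_gt0.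
have alpha0 : 0 < alpha by exact: lt_trans halpha0.
have [dD hA] := alpha_bound hdelta hbeta1 alpha0 halpha1.
have bd0 : 0 < beta * delta by rewrite mulr_gt0.
have td (t : R) : d%:R^-1 < t -> 0 < t * d%:R - 1.
  by move=> ht; rewrite subr_gt0 -ltr_pdivrMr// mul1r.
split.
  move=> t lo dt ta; have t0 : 0 < t by exact: lt_trans dt.
  have t10 : 0 < 1 + t by rewrite addr_gt0.
  have td0 := td t dt.
  rewrite (addrC d%:R 1).
  set S := delta + (1 + d%:R) / (1 + t) - d%:R.
  have SE : (1 + t) * S = 1 + delta - t * (d%:R - delta) by exact: exponent_scaled.
  have Sbd : beta * delta < (1 + t) * S by exact: exponent_gt ta dD hA.
  have S0 : 0 < S by rewrite -(pmulr_rgt0 _ t10); exact: lt_trans Sbd.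
  split.
    apply/lee_addgt0Pr => e e0; rewrite -EFinD; set s := S + e.
    have s0 : 0 < s by rewrite addr_gt0.
    apply: ereal_inf_lbound; exists s => //; split; first exact: ltW.
    pose w := s - delta + d%:R.
    have w0 : (1 + d%:R) / (1 + t) < w by rewrite /w /s /S; lra.
    have wp : 0 < w by apply: lt_trans w0; rewrite divr_gt0// addr_gt0.
    have tw : (1 + d%:R) / w < 1 + t by rewrite ltr_pdivrMr// mulrC -ltr_pdivrMr.
    pose v := Num.max d%:R^-1 ((1 + d%:R) / w - 1); pose t' := (v + t) / 2.
    have vt : v < t by rewrite gt_max dt; lra.
    have dv : d%:R^-1 <= v by rewrite le_max lexx.
    have wv : (1 + d%:R) / w - 1 <= v by rewrite le_max lexx orbT.
    have t't : t' < t by rewrite /t'; lra.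
    have vt' : v < t' by rewrite /t'; lra.
    have dt' : d%:R^-1 < t' by exact: le_lt_trans vt'.
    have t'0 : 0 < t' by exact: lt_trans dt'.
    have t'10 : 0 < 1 + t' by rewrite addr_gt0.
    apply: (W_set_measure0 hd hK cm m1 hbeta0 CR1 CL1 Q01 msupp mge mcount dt'
      (lt_trans t't ta) s0).
      rewrite exponentE//; have : (1 + d%:R) / (1 + t') < w.
        rewrite ltr_pdivrMr// mulrC -ltr_pdivrMr//; lra.
      by rewrite /w; lra.
    by apply: lt_lower_order; rewrite lo lte_fin.
  set s1 := Num.min _ S.
  have [s10|s10] := leP s1 0.
    by apply: le_trans (hausdorff_dim_ge0 _); rewrite lee_fin.
  apply: hausdorff_dim_ge.
  have s1E : s1 <= delta - (t * d%:R - 1) * S / (beta * delta) by rewrite ge_min lexx.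
  have tdS : (t * d%:R - 1) * S <= beta * delta * (delta - s1).
    have : (t * d%:R - 1) * S / (beta * delta) <= delta - s1 by lra.
    by rewrite ler_pdivrMr// [leRHS]mulrC.
  have s1d : s1 < delta.
    rewrite -subr_gt0 -(pmulr_rgt0 _ bd0); apply: lt_le_trans tdS.
    exact: mulr_gt0.
  (* Here the hypothesis on alpha makes the first term of the minimum the smaller one. *)
  have s1S : s1 < S.
    apply: le_lt_trans s1E _.
    have : (t * d%:R - 1) * (beta * delta) < (t * d%:R - 1) * ((1 + t) * S).
      by rewrite ltr_pM2l.
    have dS : (1 + t) * (delta - S) = t * d%:R - 1 by rewrite mulrBr SE; ring.
    rewrite -{1}dS => h.
    have : (delta - S) * (beta * delta) < (t * d%:R - 1) * S.
      by rewrite -(ltr_pM2l t10); lra.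
    rewrite -ltr_pdivlMr// => h'; lra.
  have h1 : t * d%:R - 1 < beta * delta * (delta - s1) / s1.
    rewrite ltr_pdivlMr//; apply: lt_le_trans tdS.
    by rewrite ltr_pM2l.
  pose w := beta * delta * (delta - s1) / s1.
  have tw : t < (w + 1) / d%:R by rewrite ltr_pdivlMr// /w; lra.
  pose u := Num.min alpha ((w + 1) / d%:R); pose t' := (t + u) / 2.
  have tu : t < u by rewrite lt_min ta.
  have ua : u <= alpha by rewrite ge_min lexx.
  have uw : u <= (w + 1) / d%:R by rewrite ge_min lexx orbT.
  have tt' : t < t' by rewrite /t'; lra.
  have t'u : t' < u by rewrite /t'; lra.
  have hk : (t' * d%:R - 1) * s1 <= beta * delta * (delta - s1).
    have : t' < (w + 1) / d%:R by exact: lt_le_trans uw.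
    by rewrite ltr_pdivlMr// -ler_pdivlMr// -/w => ?; lra.
  apply: (W_set_measure_pinfty hd hK cm m1 hbeta0 CR1 CL1 Q01 msupp mle mge mcount hpsi
    (lt_trans dt tt') (lt_le_trans t'u ua) ltr01 s10 s1d hk).
    apply: unbounded_infinite => n.
    have [|q nq [q0 hq]] := @lower_order_lt _ psi t' _ n; first by rewrite lo lte_fin.
    by exists q => //; split=> //; rewrite mul1r.
  move=> c1 c10 _.
  exact: (trivial_local_bound theta beta cm CR1 Q01 mle t' s1 c10).
move=> d1 theta0 c tau c0 dtau htau inf s; subst theta.
have [taua taub] : tau < alpha /\ tau * (2 * d%:R - delta - 1) <= delta + 2 - d%:R.
  move: htau; rewrite lt_min lte_fin => /andP[-> h]; split=> //.
  have [z|zn] := eqVneq (2 * d%:R - delta - 1) 0; first by rewrite z mulr0; lra.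
  rewrite inver (negbTE zn) -EFinM lte_fin in h.
  have zp : 0 < 2 * d%:R - delta - 1 by rewrite lt_neqAle eq_sym zn; lra.
  by rewrite -ler_pdivlMr// ltW.
have tau0 : 0 < tau by exact: lt_trans dtau.
have t10 : 0 < 1 + tau by rewrite addr_gt0.
have td0 := td tau dtau.
pose S := delta + (1 + d%:R) / (1 + tau) - d%:R.
have SE : (1 + tau) * S = 1 + delta - tau * (d%:R - delta) by exact: exponent_scaled.
have Sbd : beta * delta < (1 + tau) * S by exact: exponent_gt taua dD hA.
have S0 : 0 < S by rewrite -(pmulr_rgt0 _ t10); exact: lt_trans Sbd.
have Sd : S < delta.
  rewrite -subr_gt0 -(pmulr_rgt0 _ t10) mulrBr SE.
  by rewrite (_ : _ - _ = tau * d%:R - 1)//; ring.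
have dS : d%:R - 1 <= S.
  by rewrite -(ler_pM2l t10) SE; lra.
pose kappa := (tau - d%:R^-1) * (2 * d%:R - delta - 1).
have kappa0 : 0 <= kappa by rewrite mulr_ge0//; lra.
have kb : 0 < kappa + beta * delta by rewrite ltr_wpDl.
(* [s] may be nonpositive, whereas the construction needs a positive exponent: it is
   carried out for [s'], the largest exponent it can reach. *)
pose s' := Num.min S (beta * delta * delta / (kappa + beta * delta)).
have s'0 : 0 < s' by rewrite lt_min S0 divr_gt0// mulr_gt0.
have s'S : s' <= S by rewrite ge_min lexx.
have s'd : s' < delta by exact: le_lt_trans Sd.
have hk : kappa * s' <= beta * delta * (delta - s').
  have : s' <= beta * delta * delta / (kappa + beta * delta).
    by rewrite ge_min lexx orbT.
  by rewrite ler_pdivlMr// => ?; lra.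
have ss' : s <= s'.
  have sS : s <= S by rewrite /s ge_min lexx orbT.
  have [s0|s0] := leP s 0; first exact: le_trans (ltW s'0).
  rewrite le_min sS ler_pdivlMr//=.
  have : s <= delta - kappa * S / (beta * delta) by rewrite /s ge_min lexx.
  rewrite lerBrDr -lerBrDl ler_pdivrMr// => h.
  have : kappa * s <= kappa * S by rewrite ler_wpM2l.
  by move=> ?; lra.
have key : hausdorff_measure s' (K `&` W_set psi 0) = +oo%E.
  apply: (W_set_measure_pinfty hd hK cm m1 hbeta0 CR1 CL1 Q01 msupp mle mge mcount hpsi
    dtau taua c0 s'0 s'd hk inf) => c1 c10 c11.
  by apply: (homogeneous_local_bound beta hd hK cm CR1 Q01 msupp mle mge);
    rewrite // exponentE.
have fin := hausdorff_measure_pinfty_exponent ss' key.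
by split=> //; exact: hausdorff_dim_ge.
Qed.
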